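(* For every $c>0$ there exist constants $C=C(c)>0$ and $\gamma=\gamma(c)>0$ such that the following holds. Let $G$ be an $n$-vertex $(p,\beta)$-bijumbled graph and let $\rho=\rho(n)\in(0,1]$ satisfy $$\delta(G)\ge cpn,\qquad \beta\le\gamma pn,\qquad \rho pn\ge C(\log n)^2,\qquad\text{and}\qquad 2\mid n.$$ Then, following an $[n/2]$-uniform colouring of $G$, the percolation $G_\rho$ a.a.s. admits a rainbow perfect matching.
   Context: All graphs are finite and simple; $\delta(G)$ is the minimum degree; $\log$ is the natural logarithm. For a graph $G$ and $X,Y\subseteq V(G)$ put $\vec e_G(X,Y)=|\{(x,y)\in X\times Y: xy\in E(G)\}|$. For $0<p\le1$ and $\beta\ge0$, $G$ is $(p,\beta)$-bijumbled if $|\vec e_G(X,Y)-p|X||Y||\le\beta\sqrt{|X||Y|}$ for all $X,Y\subseteq V(G)$. A $[Q]$-uniform colouring of a graph assigns to each edge, independently, a colour chosen uniformly at random from $[Q]=\{1,\dots,Q\}$. A subgraph is rainbow if all its edges receive distinct colours. $G_\rho$ is the random spanning subgraph of $G$ obtained by retaining each edge independently with probability $\rho$, independently of the colouring; the probability is over both the colouring and the percolation. Asymptotics are as $n\to\infty$: $p,\beta,\rho$ may depend on $n$, $G=G_n$ is any sequence of graphs satisfying the hypotheses, and a.a.s. means with probability tending to $1$ as $n\to\infty$. *)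

(* Defs.v *)
From mathcomp Require Import all_boot all_order all_algebra.
From mathcomp Require Import reals.

Set Implicit Arguments.
Unset Strict Implicit.
Unset Printing Implicit Defensive.

Import Order.TTheory GRing.Theory Num.Theory.

Record sgraph (T : finType) := SGraph {
  adj :> rel T;
  adj_sym : symmetric adj;
  adj_irrefl : irreflexive adj
}.

Section Graphs.
Variables (T : finType) (G : sgraph T).

Definition edges : {set {set T}} :=
  [set e : {set T} | [exists x, exists y, G x y && (e == [set x; y])]].

Definition edge : finType := {e : {set T} | e \in edges}.

Definition degree (x : T) : nat := #|[set y | G x y]|.

(* Degrees are at most #|T|, so #|T| is neutral as soon as T is nonempty; the
   graph without vertices gets the value 0. *)
Definition min_degree : nat := \big[minn/#|T|]_(x : T) degree x.

(* Ordered pairs: an edge inside X :&: Y is counted twice. *)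
Definition dir_edges (X Y : {set T}) : nat :=
  #|[set xy in setX X Y | G xy.1 xy.2]|.

(* [partition _ [set: T]] says that the edges of M are pairwise disjoint and
   cover all the vertices. *)
Definition perfect_matching (M : {set edge}) : bool :=
  partition [set val e | e in M] [set: T].

Definition rainbow (Q : nat) (chi : {ffun edge -> 'I_Q}) (M : {set edge}) :
  bool := dinjectiveb chi (mem M).

(* F is the edge set of a spanning subgraph of G. *)
Definition has_rainbow_pm (Q : nat) (chi : {ffun edge -> 'I_Q})
    (F : {set edge}) : bool :=
  [exists M : {set edge}, [&& M \subset F, perfect_matching M & rainbow chi M]].

End Graphs.

Section RandomColouringPercolation.
Local Open Scope ring_scope.
Variables (R : realType) (T : finType) (G : sgraph T).

Definition bijumbled (p beta : R) : Prop :=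
  forall X Y : {set T},
    `|(dir_edges G X Y)%:R - p * #|X|%:R * #|Y|%:R|
      <= beta * Num.sqrt (#|X|%:R * #|Y|%:R).

(* An outcome consists of a colouring and of the set of retained edges; all the
   edge colours and all the edge retentions are independent, hence the product
   weights. *)
Definition colouring_weight (Q : nat) (chi : {ffun edge G -> 'I_Q}) : R :=
  \prod_(e : edge G) Q%:R^-1.

Definition percolation_weight (rho : R) (F : {set edge G}) : R :=
  \prod_(e : edge G) (if e \in F then rho else 1 - rho).

Definition prob_colour_perc (Q : nat) (rho : R)
    (A : {ffun edge G -> 'I_Q} -> {set edge G} -> bool) : R :=
  \sum_(chi : {ffun edge G -> 'I_Q}) \sum_(F : {set edge G} | A chi F)
    colouring_weight chi * percolation_weight rho F.

End RandomColouringPercolation.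

(* Main.v *)
Require Import Defs.
From mathcomp Require Import all_boot all_order all_algebra all_fingroup.
From mathcomp Require Import reals sequences exp.
From mathcomp Require Import ring lra zify.

(* Let q be of order ln n / (p n).  A balanced cut (A, ~: A) of G with the
   largest number of crossing edges has all its crossing degrees of order p n,
   and it expands because G is bijumbled; by Hall's theorem and a union bound
   over the violators, the crossing edges retained in G_q contain a perfect
   matching with probability at least 1/2.  Conditioning on this event, a
   perfect matching of G_q coloured by a uniform bijection onto the colours is a
   random set of pairs (edge, colour) that contains a given set S of pairs with
   probability at most (8 q / Q)^|S|, where Q = n / 2.

   For a measure with this spread, the argument of Park and Pham shows that
   retaining each pair independently with probability O(q ln n / Q) a.a.s.
   yields a superset of some member of the support: the first logarithm comes
   from the perfect matchings, the second one from the rounds of that argument.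
   McDiarmid's coupling finally replaces the independent pairs by a random
   colouring followed by a percolation. *)

Set Implicit Arguments.
Unset Strict Implicit.
Unset Printing Implicit Defensive.
Import Order.TTheory GRing.Theory Num.Theory.
Local Open Scope ring_scope.

(** * Random subsets and McDiarmid's coupling *)

Section RandomSubset.
Variables (R : realFieldType) (T : finType).
Implicit Types (p : R) (f g : {set T} -> R) (s : seq T).

Definition set_weight p (W : {set T}) : R :=
  \prod_(x : T) (if x \in W then p else 1 - p).

(** The random subset is revealed one element at a time, so that couplings become inductions on the
    list; [expect_weight] recovers the sum over all sets. *)
Fixpoint expect s p f : R :=
  if s is x :: s' then
    p * expect s' p (fun W => f (x |: W)) + (1 - p) * expect s' p f
  else f set0.

Lemma eq_expect s p f g : f =1 g -> expect s p f = expect s p g.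
Proof.
elim: s f g => [|x s IH] f g fg //=.
by rewrite (IH _ _ fg) (IH _ (fun W => g (x |: W))) // => W; rewrite fg.
Qed.

Lemma expectD s p f g :
  expect s p (fun W => f W + g W) = expect s p f + expect s p g.
Proof. by elim: s f g => [|x s IH] f g //=; rewrite !IH; ring. Qed.

Lemma expectZ s p a f : expect s p (fun W => a * f W) = a * expect s p f.
Proof. by elim: s f => [|x s IH] f //=; rewrite !IH; ring. Qed.

Lemma expect_cst s p a : expect s p (fun=> a) = a.
Proof. by elim: s => [|x s IH] //=; rewrite !IH; ring. Qed.

Lemma expectB s p f g :
  expect s p (fun W => f W - g W) = expect s p f - expect s p g.
Proof. by elim: s f g => [|x s IH] f g //=; rewrite !IH; ring. Qed.

Lemma expect_sum (I : finType) (P : pred I) s p (F : I -> {set T} -> R) :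
  expect s p (fun W => \sum_(i | P i) F i W) = \sum_(i | P i) expect s p (F i).
Proof.
elim: s F => [|x s IH] F //=.
by rewrite !IH big_split /= !mulr_sumr.
Qed.

Lemma le_expect_in s p f g : 0 <= p <= 1 ->
  (forall W : {set T}, {subset W <= s} -> f W <= g W) -> expect s p f <= expect s p g.
Proof.
move=> /andP[p0 p1]; elim: s f g => [|x s IH] f g fg /=.
  by apply: fg => y; rewrite inE.
apply: lerD; apply: ler_wpM2l; rewrite ?subr_ge0 //; apply: IH => W Ws.
  apply: fg => y; rewrite !inE => /orP[->//|/Ws ->]; exact: orbT.
by apply: fg => y /Ws; rewrite inE orbC => ->.
Qed.

Lemma le_expect s p f g : 0 <= p <= 1 ->
  (forall W, f W <= g W) -> expect s p f <= expect s p g.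
Proof. by move=> p01 fg; apply: le_expect_in. Qed.

Lemma expect_weight_seq s p f : uniq s ->
  expect s p f = \sum_(W : {set T} | W \subset s)
    (\prod_(x <- s) (if x \in W then p else 1 - p)) * f W.
Proof.
elim: s f => [|x s IH] f /=.
  move=> _; rewrite (big_pred1 set0) ?big_nil ?mul1r // => W.
  apply/subsetP/eqP => [W0|-> y]; last by rewrite inE.
  by apply/setP => z; rewrite inE; apply/negP => /W0.
move=> /andP[xs us]; rewrite !IH // [RHS](bigID (fun W : {set T} => x \in W)) /=.
have prodE (W V : {set T}) : (forall y, y \in s -> (y \in W) = (y \in V)) ->
  \prod_(y <- s) (if y \in W then p else 1 - p) =
  \prod_(y <- s) (if y \in V then p else 1 - p).
  by move=> WV; rewrite !big_seq; apply: eq_bigr => y /WV ->.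
congr (_ + _); rewrite mulr_sumr.
  rewrite [RHS](reindex_onto (fun W : {set T} => x |: W) (fun W : {set T} =>
    W :\ x)) /=; last first.
    by move=> W /andP[_ xW]; rewrite setD1K.
  apply: eq_big => W.
    rewrite setU11 andbT; apply/idP/andP.
      move=> /subsetP Ws; split.
        apply/subsetP => y; rewrite !inE => /orP[->//|/Ws ->]; exact: orbT.
      have xW : x \notin W by apply: contra xs => /Ws.
      by rewrite setU1K.
    move=> [/subsetP xWs /eqP <-]; apply/subsetP => y.
    rewrite !inE => /andP[yx /orP[yx'|yW]]; first by rewrite yx' in yx.
    by have := xWs y; rewrite !inE yW orbT (negPf yx) /= => /(_ isT).
  move=> _; rewrite big_cons setU11 mulrA; congr (_ * _ * _); apply: prodE.
  by move=> y ys; rewrite !inE; case: eqP => // yx; rewrite -yx ys in xs.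
apply: eq_big => W.
  apply/subsetP/andP.
    move=> Ws; split; last by apply: contra xs => /Ws.
    by apply/subsetP => y /Ws; rewrite inE orbC => ->.
  move=> [/subsetP Ws xW] y yW; have := Ws y yW; rewrite inE => /orP[/eqP yx|//].
  by rewrite -yx yW in xW.
move=> /subsetP Ws; rewrite big_cons.
have /negPf -> : x \notin W by apply: contra xs => /Ws.
by rewrite mulrA.
Qed.

Lemma expect_weight p f :
  expect (enum T) p f = \sum_(W : {set T}) set_weight p W * f W.
Proof.
rewrite expect_weight_seq ?enum_uniq //; apply: eq_big => W.
  by apply/subsetP => y; rewrite mem_enum.
by move=> _; rewrite /set_weight -big_enum.
Qed.

Lemma set_weight_ge0 p W : 0 <= p <= 1 -> 0 <= set_weight p W.
Proof.
by move=> /andP[p0 p1]; apply: prodr_ge0 => x _; case: ifP; rewrite ?subr_ge0.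
Qed.

Lemma sum_set_weight p : \sum_(W : {set T}) set_weight p W = 1.
Proof.
rewrite -[RHS](expect_cst (enum T) p) expect_weight.
by apply: eq_bigr => W _; rewrite mulr1.
Qed.

Definition monotone f := forall A B : {set T}, A \subset B -> f A <= f B.

(** Sprinkling: the union of the two independent random sets has density [p1 + p2 - p1 * p2], which
    is at most [p], and [f] is monotone. *)
Lemma expect_setU s p1 p2 p f :
  0 <= p1 -> 0 <= p2 -> p1 + p2 <= p -> p <= 1 -> monotone f ->
  expect s p1 (fun W1 => expect s p2 (fun W2 => f (W1 :|: W2)))
    <= expect s p f.
Proof.
move=> p1_ge0 p2_ge0 p12 p_le1; elim: s f => [|x s IH] f fmono /=; first by rewrite setU0.
have fxmono : monotone (fun W => f (x |: W)).
  by move=> A B AB; apply: fmono; apply: setUS.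
set X := expect s p1 (fun W1 => expect s p2 (fun W2 => f (x |: (W1 :|: W2)))).
set Y := expect s p1 (fun W1 => expect s p2 (fun W2 => f (W1 :|: W2))).
rewrite !expectD !expectZ.
have -> : expect s p1
   (fun W1 => expect s p2 (fun W2 => f (x |: W1 :|: (x |: W2)))) = X.
  by apply: eq_expect => W1; apply: eq_expect => W2; rewrite -setUUr.
have -> : expect s p1 (fun W1 => expect s p2 (fun W2 => f (x |: W1 :|: W2))) = X.
  by apply: eq_expect => W1; apply: eq_expect => W2; rewrite setUA.
have -> : expect s p1 (fun W1 => expect s p2 (fun W2 => f (W1 :|: (x |: W2)))) = X.
  by apply: eq_expect => W1; apply: eq_expect => W2; rewrite setUCA.
have XY : Y <= X.
  apply: le_expect => [|W1]; first by lra.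
  apply: le_expect => [|W2]; first by lra.
  by apply: fmono; apply: subsetUr.
(* The left side mixes [X] and [Y] with weight [p1 + p2 - p1 * p2] on [X]; [h1] and [h2] add up to
   the gain from raising this weight to [p]. *)
have h1 : 0 <= (p - (p1 + p2)) * (X - Y) by rewrite mulr_ge0 // subr_ge0.
have h2 : 0 <= p1 * p2 * (X - Y) by rewrite !mulr_ge0 // subr_ge0.
apply: (@le_trans _ _ (p * X + (1 - p) * Y)); first by rewrite -/Y; lra.
by apply: lerD; apply: ler_wpM2l; [lra | exact: IH | lra | exact: IH].
Qed.

Lemma expect_cat s1 s2 p f :
  expect (s1 ++ s2) p f =
    expect s1 p (fun W1 => expect s2 p (fun W2 => f (W1 :|: W2))).
Proof.
elim: s1 f => [|x s1 IH] f /=; first by apply: eq_expect => W; rewrite set0U.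
rewrite !IH; congr (_ * _ + _).
by apply: eq_expect => W1; apply: eq_expect => W2; rewrite setUA.
Qed.

(** Linearity of expectation, as an inequality because an element repeated in [s] contributes only
    once to [W]. *)
Lemma expect_sum_mem s p a (psi : T -> R) : 0 <= p <= 1 ->
  (forall x, 0 <= psi x) ->
  expect s p (fun W => a + \sum_(x in W) psi x) <= a + p * \sum_(x <- s) psi x.
Proof.
move=> p01 psi0; elim: s a => [|x s IH] a /=; first by rewrite big_set0 big_nil mulr0.
rewrite big_cons; apply: (@le_trans _ _ (p * expect s p
  (fun W => (a + psi x) + \sum_(y in W) psi y) +
    (1 - p) * expect s p (fun W => a + \sum_(y in W) psi y))).
  rewrite lerD2r; apply: ler_wpM2l; first by case/andP: p01.
  apply: le_expect => // W; rewrite -addrA lerD2l.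
  have [xW|xW] := boolP (x \in W); last by rewrite big_setU1.
  by rewrite (setUidPr _) ?sub1set // lerDr.
have := IH a; have := IH (a + psi x); nra.
Qed.

End RandomSubset.

Section ColourCoupling.
Variables (R : realFieldType) (E C : finType).
Implicit Types (f : {set E * C} -> R) (s : seq E).

(* Each element of E independently receives a uniform colour with probability
   rho and no colour otherwise. *)
Fixpoint expect_colour s (rho : R) f : R :=
  if s is e :: s' then
    (1 - rho) * expect_colour s' rho f +
    rho / #|C|%:R *
      \sum_(c : C) expect_colour s' rho (fun W => f ((e, c) |: W))
  else f set0.

(* For the indicator of "some A in H is contained in W" this holds as soon as
   each A in H assigns at most one colour to each element of E. *)
Definition one_colour_subadditive f :=
  forall e (W1 W2 : {set E * C}), (forall x, x \in W1 -> x.1 = e) ->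
  f (W1 :|: W2) <= f W2 + \sum_(x in W1) (f (x |: W2) - f W2).

(* McDiarmid's comparison: retaining each pair (e, c) independently with
   probability rho / #|C| is at most as good as the exclusive colouring. *)
Lemma expect_le_colour s (rho : R) f : 0 <= rho <= 1 -> (0 < #|C|)%N ->
  monotone f -> one_colour_subadditive f ->
  expect (allpairs pair s (enum C)) (rho / #|C|%:R) f <= expect_colour s rho f.
Proof.
move=> /andP[rho0 rho1] C0.
have p01 : 0 <= rho / #|C|%:R <= 1.
  rewrite divr_ge0 //= ler_pdivrMr ?ltr0n // mul1r.
  by apply: (le_trans rho1); rewrite ler1n.
elim: s f => [|e s IH] f fmono fsub //=.
set p := rho / _ in p01 IH *; rewrite expect_cat.
set rest := [seq (x, c) | x <- s, c <- enum C].
(* [Phi W1] averages over the pairs of the later elements when [W1] is retained at [e]; [psi x] is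
   the gain from the single pair [x]. *)
pose Phi W1 := expect rest p (fun W2 => f (W1 :|: W2)).
pose psi x := Phi [set x] - Phi set0.
have psi0 x : 0 <= psi x.
  rewrite subr_ge0; apply: le_expect => // W; apply: fmono.
  by rewrite set0U subsetUr.
apply: (@le_trans _ _
  (expect [seq (e, c) | c <- enum C] p (fun W => Phi set0 + \sum_(x in W) psi x))).
  apply: le_expect_in => // W1 W1e.
  rewrite /psi /Phi; under eq_bigr do rewrite -expectB.
  rewrite -expect_sum -expectD; apply: le_expect => // W2; rewrite set0U.
  apply: (fsub e) => x /W1e /mapP[c _ ->] //.
apply: (le_trans (expect_sum_mem _ _ p01 psi0)).
rewrite big_map big_enum /= /psi sumrB sumr_const -/p.
(* As [p * #|C| = rho], the bound given by subadditivity is exactly the mixture produced by an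
   exclusive colour at [e]. *)
have -> : Phi set0 + p * (\sum_(c : C) Phi [set (e, c)] - Phi set0 *+ #|C|) =
    (1 - rho) * Phi set0 + p * \sum_(c : C) Phi [set (e, c)].
  rewrite -[Phi set0 *+ _]mulr_natr /p; field.
  by rewrite pnatr_eq0 -lt0n.
apply: lerD; apply: ler_wpM2l.
- by rewrite subr_ge0.
- by rewrite /Phi (eq_expect _ _ (g := f)) ?IH // => W; rewrite set0U.
- by case/andP: p01.
apply: ler_sum => c _; apply: IH.
  by move=> A B AB; apply: fmono; apply: setUS.
move=> e' W1 W2 W1e'; rewrite setUCA.
apply: (le_trans (fsub _ _ _ W1e')).
by rewrite lerD2l; apply: ler_sum => x _; rewrite setUCA.
Qed.

(** Since [h c] ignores the colour of [e], exchanging [c] with [chi e] is a bijection of the pairs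
    [(c, chi)] that carries one sum to the other. *)
Lemma sum_ffun_coordinate (e : E) (h : C -> {ffun E -> C} -> R) :
  (forall c (chi chi' : {ffun E -> C}), (forall x, x != e -> chi x = chi' x) ->
    h c chi = h c chi') ->
  #|C|%:R * (\sum_(chi : {ffun E -> C}) h (chi e) chi) =
    \sum_(c : C) \sum_(chi : {ffun E -> C}) h c chi.
Proof.
move=> hdep; pose upd (chi : {ffun E -> C}) c : {ffun E -> C} :=
  [ffun x => if x == e then c else chi x].
rewrite mulr_natl -sumr_const !pair_big /=.
rewrite (reindex_inj (h := fun u : C * {ffun E -> C} => (u.2 e, upd u.2 u.1))) /=.
  apply: eq_bigr => -[c chi] _ /=; rewrite ffunE eqxx.
  by apply: hdep => x xe; rewrite ffunE (negPf xe).
move=> [c chi] [c' chi'] /= [Ee /ffunP Eu].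
have Ec := Eu e; rewrite !ffunE eqxx in Ec.
congr (_, _) => //; apply/ffunP => x; have := Eu x; rewrite !ffunE.
by case: eqP => // -> .
Qed.

Lemma expect_colour_seq s (rho : R) f : (0 < #|C|)%N -> uniq s ->
  expect_colour s rho f =
    \sum_(chi : {ffun E -> C}) (\prod_(e : E) #|C|%:R^-1) *
      expect s rho (fun F => f [set (e, chi e) | e in F]).
Proof.
move=> C0; have C0R : #|C|%:R != 0 :> R by rewrite pnatr_eq0 -lt0n.
elim: s f => [|e s IH] f /=.
  move=> _; under eq_bigr do rewrite imset0.
  rewrite sumr_const card_ffun prodr_const -[RHS]mulr_natl mulrA natrX -exprMn.
  by rewrite mulfV // expr1n mul1r.
move=> /andP[es us]; rewrite IH //.
under [in RHS]eq_bigr do rewrite mulrDr.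
rewrite big_split /= addrC; congr (_ + _).
  by rewrite mulr_sumr; apply: eq_bigr => chi _; rewrite mulrCA.
under eq_bigr do rewrite IH //.
pose w : R := \prod_(e : E) #|C|%:R^-1.
(* Intersecting with [s], which lacks [e], makes [h c] independent of [chi e] for every [F], as
   [sum_ffun_coordinate] demands. *)
pose h c (chi : {ffun E -> C}) : R := w * expect s rho
  (fun F => f ((e, c) |: [set (e, chi e) | e in F :&: [set x in s]])).
have memW (W : {set E}) : {subset W <= s} -> W = W :&: [set x in s].
  by move=> Ws; apply/setP => x; rewrite !inE andbC;
    case: (boolP (x \in W)) => [/Ws->|]; rewrite ?andbF.
have expE (g g' : {set E} -> R) : (forall W : {set E}, {subset W <= s} -> g W = g' W) ->
    expect s rho g = expect s rho g'.
  move=> gg; elim: {IH es us h memW} s g g' gg => [|x s' IH'] g g' gg /=.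
    by apply: gg => y; rewrite inE.
  rewrite (IH' g g'); last by move=> W Ws; apply: gg => y /Ws; rewrite inE orbC => ->.
  rewrite (IH' _ (fun W => g' (x |: W))) // => W Ws; apply: gg => y.
  by rewrite !inE => /orP[->//|/Ws ->]; rewrite orbT.
transitivity (rho / #|C|%:R * \sum_(c : C) \sum_(chi : {ffun E -> C}) h c chi).
  congr (_ * _); apply: eq_bigr => c _; apply: eq_bigr => chi _; congr (_ * _).
  by apply: expE => W Ws; rewrite -memW.
rewrite -(@sum_ffun_coordinate e) => [|c chi chi' chie].
  rewrite mulrA divfK // mulr_sumr; apply: eq_bigr => chi _.
  rewrite /h mulrCA; congr (_ * (_ * _)).
  by apply: expE => W Ws; rewrite imsetU1 -memW.
rewrite /h; congr (_ * _); apply: eq_expect => W; congr f; congr (_ |: _).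
apply: eq_in_imset => x; rewrite !inE => /andP[_ xs]; rewrite chie //.
by apply: contraNneq es => <-.
Qed.

Lemma expect_colour_weight (rho : R) f : (0 < #|C|)%N ->
  expect_colour (enum E) rho f =
    \sum_(chi : {ffun E -> C}) \sum_(F : {set E})
      (\prod_(e : E) #|C|%:R^-1) * set_weight rho F *
      f [set (e, chi e) | e in F].
Proof.
move=> C0; rewrite expect_colour_seq ?enum_uniq //; apply: eq_bigr => chi _.
by rewrite expect_weight mulr_sumr; apply: eq_bigr => F _; rewrite mulrA.
Qed.

End ColourCoupling.

(** * Spread measures *)

Section SpreadMeasure.
Variables (R : realFieldType) (T : finType).
Implicit Types (p q : R) (lam mu : {set T} -> R) (A B S W Z : {set T}).

(** Total mass 1 is not imposed, because the rounds below discard mass; the case [S = set0] bounds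
    the mass by 1. *)
Definition spread q lam :=
  (forall A, 0 <= lam A) /\
  (forall S, \sum_(A : {set T} | S \subset A) lam A <= q ^+ #|S|).

Definition support_bounded (r : nat) lam :=
  forall A, lam A != 0 -> (#|A| <= r)%N.

Definition mass lam : R := \sum_(A : {set T}) lam A.

Definition hits lam W : bool := [exists A, (lam A != 0) && (A \subset W)].

Definition hit_prob p lam : R :=
  expect (enum T) p (fun W => (hits lam W)%:R).

(** The minimum fragment of Park and Pham. When [lam A != 0], the set [A] itself is a candidate, so
    the minimum is attained. *)
Definition fragment lam A W : {set T} :=
  [arg min_(B < A | (lam B != 0%R) && (B \subset W :|: A)) #|B :\: W|]%N :\: W.

Definition hitting lam Z : {set T} :=
  odflt set0 [pick B | (lam B != 0) && (B \subset Z)].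

Lemma fragmentP lam A W : lam A != 0 ->
  exists B, [/\ lam B != 0, B \subset W :|: A, fragment lam A W = B :\: W &
    forall B', lam B' != 0 -> B' \subset W :|: A -> (#|B :\: W| <= #|B' :\: W|)%N].
Proof.
move=> lA; rewrite /fragment; case: arg_minnP => [|B /andP[lB BWA] Bmin].
  by rewrite lA subsetUr.
by exists B; split=> // B' lB' B'WA; apply: Bmin; rewrite lB'.
Qed.

Lemma fragment_sub lam A W : lam A != 0 -> fragment lam A W \subset A.
Proof.
by move=> lA; have [B [_ BWA -> _]] := fragmentP W lA; rewrite subDset.
Qed.

Lemma fragment_disjoint lam A W : lam A != 0 -> [disjoint W & fragment lam A W].
Proof.
move=> lA; have [B [_ _ -> _]] := fragmentP W lA.
by rewrite disjoint_sym -setI_eq0 setIDAC setDIl setDv setI0.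
Qed.

(* By minimality every member of the support inside W :|: T meets the complement
   of W in exactly T: knowing only Z = W :|: T, there are few choices for T. *)
Lemma fragment_sub_hitting lam A W : lam A != 0 ->
  fragment lam A W \subset hitting lam (W :|: fragment lam A W).
Proof.
move=> lA; have [B [lB BWA -> Bmin]] := fragmentP W lA.
rewrite /hitting; case: pickP => [B' /andP[lB' B'Z]|/(_ B)] /=; last first.
  by rewrite lB -subDset subxx.
have B'B : B' :\: W \subset B :\: W by rewrite subDset.
have /eqP <- : B' :\: W == B :\: W.
  rewrite eqEcard B'B /=; apply: Bmin => //.
  by apply: (subset_trans B'Z); rewrite subUset subsetUl subDset setUA setUid.
exact: subsetDl.
Qed.

(** Inserting [S] turns factors [1 - p] into [p]; bounding each [1 - p] by 1 avoids a division and
    covers [p = 1]. *)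
Lemma set_weight_setU p W S : 0 <= p <= 1 -> [disjoint W & S] ->
  set_weight p W * p ^+ #|S| <= set_weight p (W :|: S).
Proof.
move=> /andP[p0 p1] WS; rewrite /set_weight.
rewrite (bigID (mem S)) [leRHS](bigID (mem S)) /= mulrAC.
have -> : \prod_(x | x \notin S) (if x \in W :|: S then p else 1 - p) =
          \prod_(x | x \notin S) (if x \in W then p else 1 - p).
  by apply: eq_bigr => x /negPf xS; rewrite inE xS orbF.
apply: ler_wpM2r.
  by apply: prodr_ge0 => x _; case: ifP; rewrite ?subr_ge0.
rewrite [leRHS](eq_bigr (fun=> p)); last by move=> x xS; rewrite inE xS orbT.
rewrite prodr_const ler_piMl ?exprn_ge0 //; apply: prodr_ile1 => x xS.
by case: ifP => _; rewrite ?p0 //= subr_ge0 p1 gerBl.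
Qed.

Lemma sum_set_weight_setU p S (P : pred {set T}) : 0 < p <= 1 ->
  \sum_(W : {set T} | [disjoint W & S] && P (W :|: S)) set_weight p W <=
  p ^- #|S| * \sum_(Z : {set T} | P Z) set_weight p Z.
Proof.
move=> /andP[p0 p1]; have p01 : 0 <= p <= 1 by rewrite (ltW p0).
rewrite mulrC ler_pdivlMr ?exprn_gt0 // mulr_suml.
rewrite [leRHS](bigID (fun Z => S \subset Z)) /=.
apply: ler_wpDr; first by apply: sumr_ge0 => Z _; exact: set_weight_ge0.
rewrite [leRHS](reindex_onto (fun W => W :|: S) (fun Z => Z :\: S)) /=; last first.
  move=> Z /andP[_ /subsetP SZ]; apply/setP => x; rewrite !inE.
  by case: (boolP (x \in S)) => [/SZ ->|_]; rewrite ?orbF.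
rewrite [leRHS](eq_bigl (fun W => [disjoint W & S] && P (W :|: S))).
  by apply: ler_sum => W /andP[WS _]; apply: set_weight_setU.
move=> W; rewrite subsetUr andbT andbC; congr (_ && _).
by rewrite setDUl setDv setU0; apply/eqP/idP => [/setDidPl|/setDidPl].
Qed.

(** Sum over the possible fragments [S]: passing from [W] to [Z = W :|: S] costs [p ^- t], the sets
    [A] containing [S] have mass at most [q ^+ t], and for a given [Z] all candidates [S] lie in
    [hitting lam Z], which has at most [r] elements. *)
Lemma sum_fragment_card (r t : nat) p q lam : 0 < p <= 1 -> 0 <= q ->
  spread q lam -> support_bounded r lam ->
  \sum_(W : {set T}) set_weight p W *
    (\sum_(A : {set T} | (lam A != 0) && (#|fragment lam A W| == t)) lam A)
  <= 'C(r, t)%:R * (q / p) ^+ t.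
Proof.
move=> p01 q0 [lam0 lamq] lamr; have /andP[p0 p1] := p01.
have w0 W : 0 <= set_weight p W by apply: set_weight_ge0; rewrite (ltW p0).
(* Only those properties of the fragment are kept that relate [S] to [W] alone or to [A] alone, so
   that the sums over [W] and [A] factor. *)
pose ok S W A := [&& #|S| == t,
  [disjoint W & S] && (S \subset hitting lam (W :|: S)) & S \subset A].
apply: (@le_trans _ _ (\sum_(W : {set T}) \sum_(A : {set T}) \sum_(S : {set T} |
  ok S W A) set_weight p W * lam A)).
  apply: ler_sum => W _; rewrite mulr_sumr big_mkcond /=.
  apply: ler_sum => A _; case: ifP => [/andP[lA /eqP ft]|_]; last first.
    by apply: sumr_ge0 => S _; rewrite mulr_ge0.
  rewrite (bigD1 (fragment lam A W)) /= ?lerDl.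
    by apply: sumr_ge0 => S _; rewrite mulr_ge0.
  by rewrite /ok ft eqxx fragment_disjoint // fragment_sub_hitting // fragment_sub.
have -> : \sum_(W : {set T}) \sum_(A : {set T}) \sum_(S : {set T} |
  ok S W A) set_weight p W * lam A =
  \sum_(S : {set T} | #|S| == t)
    (\sum_(W : {set T} | [disjoint W & S] && (S \subset hitting lam (W :|: S)))
      set_weight p W) *
    (\sum_(A : {set T} | S \subset A) lam A).
  have swap W : \sum_(A : {set T}) \sum_(S : {set T} | ok S W A) set_weight p W * lam A =
      \sum_(S : {set T} | #|S| == t) \sum_(A : {set T} | ok S W A) set_weight p W * lam A.
    by rewrite (exchange_big_dep (fun S : {set T} => #|S| == t)) //= => A S _ /and3P[].
  rewrite (eq_bigr _ (fun W _ => swap W)).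
  rewrite exchange_big /=; apply: eq_bigr => S St.
  rewrite mulr_suml [RHS]big_mkcond /=; apply: eq_bigr => W _.
  case: ifP => [cW|ncW].
    by rewrite mulr_sumr; apply: eq_bigl => A; rewrite /ok St cW.
  by rewrite big_pred0 // => A; rewrite /ok ncW andbF.
apply: (@le_trans _ _ (\sum_(S : {set T} | #|S| == t)
   (q / p) ^+ t * \sum_(Z : {set T} | S \subset hitting lam Z) set_weight p Z)).
  apply: ler_sum => S /eqP St; rewrite mulrC expr_div_n -mulrA -St.
  apply: ler_pM => //; first by apply: sumr_ge0 => A _.
    by apply: sumr_ge0 => W _.
  exact: sum_set_weight_setU.
rewrite -mulr_sumr mulrC ler_wpM2r ?exprn_ge0 ?divr_ge0 ?(ltW p0) //.
rewrite (exchange_big_dep xpredT) //=.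
apply: (@le_trans _ _ (\sum_(Z : {set T}) set_weight p Z * 'C(r, t)%:R)); last first.
  by rewrite -mulr_suml sum_set_weight mul1r.
apply: ler_sum => Z _; rewrite sumr_const -[leLHS]mulr_natr ler_wpM2l // ler_nat.
have -> : #|[pred S : {set T} | #|S| == t & S \subset hitting lam Z]| =
    'C(#|hitting lam Z|, t).
  by rewrite -cards_draws cardsE; apply: eq_card => S; rewrite !inE andbC.
apply: leq_bin2l; rewrite /hitting; case: pickP => [B /andP[/lamr //]|_] /=.
by rewrite cards0.
Qed.

(** The push-forward of [lam] to its fragments, without the large ones; it inherits the spread
    because a fragment is a subset of its set. *)
Definition reduce (r' : nat) lam W : {set T} -> R := fun S =>
  \sum_(A : {set T} | (lam A != 0) && (#|fragment lam A W| <= r')%N && (fragment lam A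
    W == S)) lam A.

Lemma sum_reduce r' lam W (P : pred {set T}) :
  \sum_(S : {set T} | P S) reduce r' lam W S =
  \sum_(A : {set T} | (lam A != 0) && (#|fragment lam A W| <= r')%N && P (fragment lam
    A W)) lam A.
Proof.
rewrite [RHS](partition_big (fragment lam ^~ W) P) /=; last by move=> A /andP[].
apply: eq_bigr => S PS; apply: eq_bigl => A.
by case: (eqVneq (fragment lam A W) S) => [->|]; rewrite ?andbF // PS !andbT.
Qed.

Lemma reduce_spread r' q lam W : spread q lam -> spread q (reduce r' lam W).
Proof.
move=> [lam0 lamq]; split=> [S|S]; first by apply: sumr_ge0 => A _.
apply: le_trans (lamq S); rewrite sum_reduce.
rewrite [leLHS]big_mkcond [leRHS]big_mkcond /=; apply: ler_sum => A _.
case: ifP => [/andP[/andP[lA _] SA]|_]; last by case: ifP.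
by rewrite (subset_trans SA) // fragment_sub.
Qed.

Lemma reduce_neq0 r' lam W S : reduce r' lam W S != 0 ->
  exists2 A, lam A != 0 & (#|fragment lam A W| <= r')%N /\ fragment lam A W = S.
Proof.
move=> lS; have [A /andP[/andP[lA Ar] /eqP AS]|none] := pickP
  (fun A => (lam A != 0) && (#|fragment lam A W| <= r')%N && (fragment lam A W == S)).
  by exists A.
by rewrite /reduce big_pred0 ?eqxx in lS.
Qed.

Lemma reduce_bounded r' lam W : support_bounded r' (reduce r' lam W).
Proof. by move=> S /reduce_neq0[A _ [Ar <-]]. Qed.

Lemma reduce_hits r' lam W1 W2 :
  hits (reduce r' lam W1) W2 -> hits lam (W1 :|: W2).
Proof.
move=> /existsP[S /andP[/reduce_neq0[A lA [_ <-]] SW2]].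
have [B [lB _ fB _]] := fragmentP W1 lA; rewrite fB in SW2.
by apply/existsP; exists B; rewrite lB -subDset.
Qed.

Lemma hits_mono lam : monotone (fun W => (hits lam W)%:R : R).
Proof.
move=> A B AB; case: (boolP (hits lam A)) => [/existsP[S /andP[lS SA]]|_].
  have -> // : hits lam B by apply/existsP; exists S; rewrite lS (subset_trans SA).
by rewrite ler0n.
Qed.

Lemma hit_prob_ge0 p lam : 0 <= p <= 1 -> 0 <= hit_prob p lam.
Proof.
move=> p01; rewrite -[X in X <= _](expect_cst (enum T) p).
by apply: le_expect => // W; rewrite ler0n.
Qed.

Lemma sum_mass_reduce (r r' : nat) p q lam : 0 < p <= 1 -> 0 <= q ->
  spread q lam -> support_bounded r lam ->
  mass lam - \sum_(t < r.+1 | (r' < t)%N) 'C(r, t)%:R * (q / p) ^+ t <=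
  \sum_(W : {set T}) set_weight p W * mass (reduce r' lam W).
Proof.
move=> p01 q0 lamq lamr; have lam0 := lamq.1.
have w0 W : 0 <= set_weight p W.
  by apply: set_weight_ge0; case/andP: p01 => /ltW -> ->.
rewrite lerBlDr; apply: (@le_trans _ _ (\sum_(W : {set T}) set_weight p W * mass
  (reduce r' lam W) +
  \sum_(t < r.+1 | (r' < t)%N) \sum_(W : {set T}) set_weight p W *
    (\sum_(A : {set T} | (lam A != 0) && (#|fragment lam A W| == t)) lam A))); last first.
  by rewrite lerD2l; apply: ler_sum => t _; apply: sum_fragment_card.
rewrite [X in _ + X]exchange_big /= -big_split /=.
rewrite -[mass lam]mul1r -(sum_set_weight T p) mulr_suml; apply: ler_sum => W _.
rewrite -mulr_sumr -mulrDr ler_wpM2l // /mass sum_reduce.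
rewrite (bigID (fun A => lam A == 0)) /= big1 ?add0r; last by move=> A /eqP.
rewrite [leLHS](bigID (fun A => #|fragment lam A W| <= r')%N) /=; apply: lerD.
  by rewrite le_eqVlt; apply/orP; left; apply/eqP/eq_bigl => A; rewrite andbT.
rewrite (exchange_big_dep (fun A => lam A != 0)) /=; last by move=> t A _ /andP[].
rewrite big_mkcondr /=; apply: ler_sum => A lA.
case: ifP => [|_]; last by apply: sumr_ge0.
rewrite -ltnNge => r'f.
have fr : (#|fragment lam A W| < r.+1)%N.
  by rewrite ltnS (leq_trans _ (lamr A lA)) // subset_leq_card // fragment_sub.
by rewrite (bigD1 (Ordinal fr)) /= ?r'f ?lA ?eqxx // lerDl; apply: sumr_ge0.
Qed.

(** One round: expose a [p1]-random set, pass to the fragments, lose on average the mass of those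
    larger than [r'], and let an independent [p2]-random set hit the reduced measure. *)
Lemma hit_prob_round (r r' : nat) p1 p2 p q f lam :
  0 < p1 -> 0 <= p2 -> p1 + p2 <= p -> p <= 1 -> 0 <= q ->
  spread q lam -> support_bounded r lam ->
  (forall mu, spread q mu -> support_bounded r' mu -> mass mu - f <= hit_prob p2 mu) ->
  mass lam - (\sum_(t < r.+1 | (r' < t)%N) 'C(r, t)%:R * (q / p1) ^+ t + f)
    <= hit_prob p lam.
Proof.
move=> p1_gt0 p2_ge0 p12 p_le1 q0 lamq lamr IH.
have p1_le1 : p1 <= 1 by lra.
apply: le_trans (expect_setU (enum T) (ltW p1_gt0) p2_ge0 p12 p_le1 (@hits_mono lam)).
rewrite expect_weight.
apply: (@le_trans _ _ (\sum_(W : {set T}) set_weight p1 W * (mass (reduce r' lam W) -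
  f))).
  rewrite [leRHS](eq_bigr _ (fun W _ => mulrBr _ _ _)).
  rewrite sumrB -mulr_suml sum_set_weight mul1r.
  have := @sum_mass_reduce r r' p1 q lam; rewrite p1_gt0 p1_le1 => /(_ isT q0 lamq lamr).
  by lra.
apply: ler_sum => W _; rewrite ler_wpM2l ?set_weight_ge0 ?(ltW p1_gt0) //.
apply: le_trans (IH _ (reduce_spread r' W lamq) (@reduce_bounded r' lam W)) _.
apply: le_expect => [|W2]; first by lra.
case: (boolP (hits (reduce r' lam W) W2)) => [/reduce_hits -> //|_].
by rewrite ler0n.
Qed.

(** Such a measure lives on the empty set, which every [W] contains. *)
Lemma hit_prob_bounded0 p q lam : 0 <= p <= 1 -> spread q lam ->
  support_bounded 0 lam -> mass lam <= hit_prob p lam.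
Proof.
move=> p01 [lam0 lamq] lamr.
have massE : mass lam = lam set0.
  rewrite /mass (bigD1 set0) //= big1 ?addr0 // => A A0; apply/eqP.
  by apply: contraNT A0 => /lamr; rewrite leqn0 cards_eq0.
have [l0|l0] := eqVneq (lam set0) 0; first by rewrite massE l0 hit_prob_ge0.
have mass1 : mass lam <= 1.
  rewrite -[leRHS](expr0 q) -(cards0 T); apply: le_trans (lamq set0).
  by rewrite /mass le_eqVlt; apply/orP; left; apply/eqP/eq_bigl => A; rewrite sub0set.
apply: (le_trans mass1); rewrite -[X in X <= _](expect_cst (enum T) p).
apply: le_expect => // W; have -> // : hits lam W.
by apply/existsP; exists set0; rewrite l0 sub0set.
Qed.

(** A round with [p1 = L * q] and [r' = 0]: each fragment size [t] costs at most
    [(s / L) ^+ t <= s / L], and there are [s] sizes. *)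
Lemma hit_prob_last (s : nat) (L : R) p q lam : (0 < s)%N -> s%:R <= L ->
  0 < q -> L * q <= p -> p <= 1 -> spread q lam -> support_bounded s lam ->
  mass lam - s%:R ^+ 2 / L <= hit_prob p lam.
Proof.
move=> s0 sL q0 Lqp p_le1 lamq lamr.
have L0 : 0 < L by apply: lt_le_trans sL; rewrite ltr0n.
have := @hit_prob_round s 0 (L * q) 0 p q 0 lam.
rewrite mulr_gt0 // addr0 addr0 lexx => /(_ isT isT Lqp p_le1 (ltW q0) lamq lamr) H.
apply: le_trans (H _); last first.
  move=> mu muq mur; rewrite subr0; apply: (hit_prob_bounded0 _ muq mur).
  by rewrite lexx ler01.
rewrite lerD2l lerN2 big_mkcond big_ord_recl /= add0r.
have -> : s%:R ^+ 2 / L = \sum_(i < s) s%:R / L :> R.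
  by rewrite sumr_const card_ord -mulr_natr; ring.
apply: ler_sum => i _; rewrite /bump /= add1n.
have -> : q / (L * q) = L^-1 by field; rewrite !gt_eqF.
apply: (@le_trans _ _ (s%:R ^+ i.+1 * L^-1 ^+ i.+1)).
  rewrite ler_wpM2r ?exprn_ge0 ?invr_ge0 ?(ltW L0) // -natrX ler_nat.
  rewrite (leq_trans _ (_ : (s ^_ i.+1 <= _)%N)) //.
    by rewrite -bin_ffact leq_pmulr // fact_gt0.
  by rewrite ffact_prod -[X in (_ <= s ^ X)%N]card_ord -prod_nat_const;
    apply: leq_prod => j _; apply: leq_subr.
rewrite -exprMn exprS ler_piMr ?divr_ge0 ?ler0n ?(ltW L0) //.
by rewrite exprn_ile1 ?divr_ge0 ?ler0n ?(ltW L0) // ler_pdivrMr // mul1r.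
Qed.

(** A round with [p1 = 64 * q]: the binomial coefficients add up to [4 ^ h], and every [t > h]
    brings a factor of at most [64^-1 ^+ h]. *)
Lemma hit_prob_halve (h : nat) p q f lam : 0 < q ->
  64 * q <= p -> p <= 1 -> spread q lam -> support_bounded (h * 2) lam ->
  (forall mu, spread q mu -> support_bounded h mu ->
     mass mu - f <= hit_prob (p - 64 * q) mu) ->
  mass lam - (16^-1 ^+ h + f) <= hit_prob p lam.
Proof.
move=> q0 qp p_le1 lamq lamr IH.
apply: le_trans (@hit_prob_round (h * 2) h (64 * q) (p - 64 * q) p q f lam _ _ _ p_le1
  (ltW q0) lamq lamr IH); try by lra.
rewrite lerD2l lerN2 lerD2r.
have -> : q / (64 * q) = 64^-1 by field; rewrite gt_eqF.
apply: (@le_trans _ _ (\sum_(t < (h * 2).+1) 'C(h * 2, t)%:R * 64^-1 ^+ h)).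
  rewrite [leLHS]big_mkcond /=; apply: ler_sum => t _.
  case: ifP => [ht|_]; last by rewrite mulr_ge0 // exprn_ge0 // invr_ge0.
  rewrite ler_wpM2l // ler_wiXn2l ?invr_ge0 ?(ltnW ht) //.
  by rewrite invf_le1 // ler1n.
rewrite -mulr_suml -natr_sum.
have -> : (\sum_(t < (h * 2).+1) 'C(h * 2, t) = 4 ^ h)%N.
  have := expnDn 1 1 (h * 2); rewrite addn1 mulnC expnM => ->.
  by apply: eq_bigr => i _; rewrite !exp1n !muln1.
rewrite natrX -exprMn.
by have -> : 4 * 64^-1 = 16^-1 :> R by field.
Qed.

(* k rounds of halving followed by one round that removes fragments of size
   at most s altogether. *)
Lemma hit_prob_rounds (k s : nat) (L : R) p q lam : (0 < s)%N -> s%:R <= L ->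
  0 < q -> ((64 * k)%:R + L) * q <= p -> p <= 1 ->
  spread q lam -> support_bounded (s * 2 ^ k) lam ->
  mass lam - (s%:R ^+ 2 / L + 2 * 16^-1 ^+ s) <= hit_prob p lam.
Proof.
move=> s0 sL q0 qp p_le1 lamq lamr.
(* A budget for [k] halving rounds: its increment [16^-1 ^+ s * 2^-1 ^+ k] is at least the loss
   [16^-1 ^+ (s * 2 ^ k)] of the round that halves [s * 2 ^ k.+1]. *)
pose g (k : nat) : R := 16^-1 ^+ s * (2 - 2 * 2^-1 ^+ k).
have L0 : 0 < L by apply: lt_le_trans sL; rewrite ltr0n.
have e0 : 0 <= 16^-1 ^+ s :> R by rewrite exprn_ge0 // invr_ge0.
apply: (@le_trans _ _ (mass lam - (s%:R ^+ 2 / L + g k))).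
  have : 0 <= 16^-1 ^+ s * 2^-1 ^+ k :> R.
    by rewrite mulr_ge0 // exprn_ge0 // invr_ge0.
  by rewrite /g; lra.
elim: k p qp p_le1 lam lamq lamr => [|k IH] p qp p_le1 lam lamq lamr.
  rewrite /g expr0 !mulr1 subrr mulr0 addr0.
  by rewrite muln0 add0r in qp; rewrite muln1 in lamr; apply: (hit_prob_last s0 sL q0 qp).
rewrite mulnSr natrD in qp.
have k0 : 0 <= (64 * k)%:R + L by rewrite addr_ge0 ?ler0n ?(ltW L0).
have kq0 := mulr_ge0 k0 (ltW q0).
apply: le_trans (@hit_prob_halve (s * 2 ^ k) p q (s%:R ^+ 2 / L + g k) lam q0 _ p_le1
  lamq _ _); last first.
- move=> mu muq mur; apply: IH => //; lra.
- by rewrite -mulnA -expnSr.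
- lra.
have : 16^-1 ^+ (s * 2 ^ k) <= 16^-1 ^+ s * 2^-1 ^+ k :> R.
  apply: (@le_trans _ _ (16^-1 ^+ s * 16^-1 ^+ k)); last first.
    rewrite ler_wpM2l // lerXn2r ?nnegrE ?invr_ge0 //.
    by rewrite lef_pV2 ?posrE // ler_nat.
  rewrite -exprD ler_wiXn2l ?invr_ge0 //; first by rewrite invf_le1 // ler1n.
  have : (k < 2 ^ k)%N by apply: ltn_expl.
  by nia.
rewrite /g [2^-1 ^+ k.+1]exprS;
  move: (16^-1 ^+ (s * 2 ^ k)) (16^-1 ^+ s) (2^-1 ^+ k) => a b d.
by lra.
Qed.

End SpreadMeasure.

(** * Hall's theorem and randomly coloured matchings *)

Section Hall.
Variables (T1 T2 : finType).
Implicit Types (g : T1 -> T2 -> bool) (A S : {set T1}).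

Definition nbrs g S : {set T2} := [set y | [exists x in S, g x y]].

Lemma nbrsP g S y : reflect (exists2 x, x \in S & g x y) (y \in nbrs g S).
Proof. by rewrite inE; apply: exists_inP. Qed.

(** Induction on [#|A|], according to whether some nonempty proper subset of [A] is tight; [y0]
    provides a total function when [A] is empty. *)
Lemma Hall (y0 : T2) g A :
  (forall S, S \subset A -> (#|S| <= #|nbrs g S|)%N) ->
  exists f : T1 -> T2, {in A &, injective f} /\ (forall x, x \in A -> g x (f x)).
Proof.
move: {2}#|A|.+1 (ltnSn #|A|) => n; elim: n g A => // n IH g A An hall.
have [->|[x0 x0A]] := set_0Vmem A.
  by exists (fun=> y0); split=> [x x'|x]; rewrite inE.
have [tight|notight] := pickP (fun S : {set T1} =>
  [&& S \subset A, S != set0, S != A & #|nbrs g S| <= #|S|]%N); last first.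
  have exp S : S \subset A -> S != set0 -> S != A -> (#|S| < #|nbrs g S|)%N.
    move=> SA S0 S1; rewrite ltnNge; apply/negP => le.
    by have := notight S; rewrite SA S0 S1 le.
  have /card_gt0P[z /nbrsP[x /set1P -> gxz]] : (0 < #|nbrs g [set x0]|)%N.
    by rewrite (leq_trans _ (hall _ _)) ?cards1 ?sub1set.
  (* Without a tight subset any neighbour [z] of [x0] will do: deleting it costs the other sets one
     neighbour, which strict expansion affords. *)
  have [||f [finj fg]] := IH (fun x y => g x y && (y != z)) (A :\ x0).
  - by move: An; rewrite (cardsD1 x0 A) x0A.
  - move=> S SA'; have SA : S \subset A := subset_trans SA' (subsetDl _ _).
    have [->|S0] := eqVneq S set0; first by rewrite cards0.
    have S1 : S != A.
      by apply: contraTneq SA' => ->; apply/subsetPn; exists x0; rewrite ?inE ?eqxx.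
    have -> : nbrs (fun x y => g x y && (y != z)) S = nbrs g S :\ z.
      apply/setP => y; rewrite in_setD1; apply/nbrsP/andP.
        by move=> [x' x'S /andP[gy yz]]; split=> //; apply/nbrsP; exists x'.
      by move=> [yz /nbrsP[x' x'S gy]]; exists x'; rewrite ?gy.
    have := exp S SA S0 S1; rewrite (cardsD1 z (nbrs g S)).
    by case: (z \in _) => /=; lia.
  exists (fun x => if x == x0 then z else f x); split=> [x1 x2 x1A x2A|x1 x1A].
    have [->|x10] := eqVneq x1 x0; have [->|x20] := eqVneq x2 x0 => //.
    - move=> zf; have := fg x2; rewrite !inE x20 x2A => /(_ isT).
      by rewrite -zf eqxx andbF.
    - move=> fz; have := fg x1; rewrite !inE x10 x1A => /(_ isT).
      by rewrite fz eqxx andbF.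
    - by apply: finj; rewrite !inE ?x10 ?x20.
  have [->//|x10] := eqVneq x1 x0.
  by have := fg x1; rewrite !inE x10 x1A => /(_ isT) /andP[].
move=> /and4P[SA S0 S1 Stight].
have [||f1 [f1inj f1g]] := IH g tight.
- by rewrite -ltnS; apply: leq_trans An; rewrite ltnS proper_card // properEneq S1.
- by move=> S SS; apply: hall; apply: subset_trans SA.
(* Outside [tight] its neighbours are forbidden; Hall's condition for [S :|: tight] and tightness
   leave enough neighbours for [S]. *)
have [||f2 [f2inj f2g]] := IH (fun x y => g x y && (y \notin nbrs g tight)) (A :\: tight).
- rewrite -ltnS; apply: leq_trans An; rewrite ltnS cardsD (setIidPr SA).
  have := subset_leq_card SA; move: S0; rewrite -card_gt0; lia.
- move=> S SA'; have /hall : S :|: tight \subset A.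
    by rewrite subUset SA (subset_trans SA') ?subsetDl.
  have dST : [disjoint S & tight].
    by rewrite -setI_eq0 -subset0; apply/subsetP => x;
      rewrite !inE => /andP[/(subsetP SA')]; rewrite inE => /andP[/negPf ->].
  have -> : nbrs g (S :|: tight) = nbrs (fun x y =>
    g x y && (y \notin nbrs g tight)) S :|: nbrs g tight.
    apply/setP => y; rewrite in_setU; apply/nbrsP/orP.
      move=> [x xST gxy]; have [yN|yN] := boolP (y \in nbrs g tight); first by right.
      left; apply/nbrsP; exists x; rewrite ?gxy //.
      move: xST; rewrite inE => /orP[//|xt]; case/negP: yN; apply/nbrsP; by exists x.
    move=> [/nbrsP[x xS /andP[gxy _]]|/nbrsP[x xt gxy]]; exists x => //.
      by rewrite inE xS.
    by rewrite inE xt orbT.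
  rewrite cardsU (disjoint_setI0 dST) cards0 subn0.
  by move=> /leq_trans /(_ (leq_card_setU _ _).1); lia.
exists (fun x => if x \in tight then f1 x else f2 x); split=> [x1 x2 x1A x2A|x1 x1A].
  case: ifP => x1t; case: ifP => x2t.
  - exact: f1inj.
  - move=> E; have := f2g x2; rewrite inE x2t x2A => /(_ isT) /andP[_ /negP[]].
    by rewrite -E; apply/nbrsP; exists x1 => //; apply: f1g.
  - move=> E; have := f2g x1; rewrite inE x1t x1A => /(_ isT) /andP[_ /negP[]].
    by rewrite E; apply/nbrsP; exists x2 => //; apply: f1g.
  - by apply: f2inj; rewrite inE ?x1t ?x2t.
case: ifP => x1t; first exact: f1g.
by have := f2g x1; rewrite inE x1t x1A => /(_ isT) /andP[].
Qed.

End Hall.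

(** The falling factorial [(s * 2) ^_ s] has [s] factors of size at least [s], and it is the
    factorial of [s] times a binomial coefficient that is at most [4 ^ s]. *)
Lemma expn_self_le_fact (s : nat) : (s ^ s <= 4 ^ s * s`!)%N.
Proof.
have -> : (4 ^ s = 2 ^ (s * 2))%N by rewrite mulnC expnM.
have : ('C(s * 2, s) <= 2 ^ (s * 2))%N.
  have -> : (2 ^ (s * 2) = \sum_(i < (s * 2).+1) 'C(s * 2, i))%N.
    rewrite -[2%N]/(1 + 1)%N expnDn.
    by apply: eq_bigr => i _; rewrite !exp1n !muln1.
  have sl : (s < (s * 2).+1)%N by lia.
  by rewrite (bigD1 (Ordinal sl)) //= leq_addr.
move=> /(leq_mul (leqnn s`!)); rewrite mulnC bin_ffact [leqRHS]mulnC.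
apply: leq_trans; rewrite ffact_prod -[X in (_ ^ X <= _)%N]card_ord -prod_nat_const.
by apply: leq_prod => i _; have := ltn_ord i; lia.
Qed.

(** Since [Q * (s - i) <= s * (Q - i)], the ratio of [Q ^ s] to [Q ^_ s] is largest at [Q = s], the
    case of [expn_self_le_fact]. *)
Lemma expn_le_ffact (Q s : nat) : (s <= Q)%N -> (Q ^ s <= 4 ^ s * Q ^_ s)%N.
Proof.
move=> sQ; have [->|s0] := posnP s; first by rewrite ffactn0.
rewrite -(@leq_pmul2r (s ^ s)) ?expn_gt0 ?s0 //.
apply: (@leq_trans (Q ^ s * (4 ^ s * s`!))).
  by rewrite leq_mul2l expn_self_le_fact orbT.
rewrite mulnCA -mulnA leq_mul2l; apply/orP; right.
rewrite -ffactnn !ffact_prod.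
have cst (a : nat) : (a ^ s = \prod_(i < s) a)%N by rewrite prod_nat_const card_ord.
rewrite !cst -!big_split /=; apply: leq_prod => i _; have := ltn_ord i; nia.
Qed.

Lemma card_perm_agree (C : finType) (D : {set C}) (sigma0 : {perm C}) (P : pred {perm
  C}) :
  (forall sigma, P sigma -> {in D, sigma =1 sigma0}) ->
  (#|[pred sigma | P sigma]| <= (#|C| - #|D|)`!)%N.
Proof.
move=> agree; have <- : #|perm_on (~: D)| = (#|C| - #|D|)`!.
  by rewrite card_perm; congr (_`!); rewrite cardsCs setCK.
rewrite -(card_imset _ (mulIg (sigma0^-1)%g)); apply: subset_leq_card.
apply/subsetP => _ /imsetP[sigma Psigma ->]; rewrite inE in Psigma.
apply/subsetP => x; rewrite !inE permM; apply: contra => xD.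
by rewrite (agree _ Psigma) // permK.
Qed.

Lemma sum_set_weight_supset (R : realFieldType) (E : finType) (q : R) (S : {set E}) :
  \sum_(F : {set E} | S \subset F) set_weight q F = q ^+ #|S|.
Proof.
pose b e := if e \in S then 0 else 1 - q.
have -> : q ^+ #|S| = \prod_(e : E) (q + b e).
  rewrite (bigID (mem S)) /= [X in _ * X]big1 ?mulr1; last first.
    by move=> e /negPf eS; rewrite /b eS addrC subrK.
  by rewrite -prodr_const; apply: eq_bigr => e eS; rewrite /b eS addr0.
rewrite bigA_distr big_mkcond; apply: eq_bigr => F _.
case: ifP => [/subsetP SF|/negbT/subsetPn[e eS eF]].
  apply: eq_bigr => e _; rewrite /b; case: (boolP (e \in F)) => // eF.
  by rewrite ifN //; apply: contra eF => /SF.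
by rewrite (bigD1 e) //= (negPf eF) /b eS mul0r.
Qed.

Lemma sum_set_weight_disjoint (R : realFieldType) (E : finType) (q : R) (D : {set E}) :
  \sum_(F : {set E} | [disjoint F & D]) set_weight q F = (1 - q) ^+ #|D|.
Proof.
rewrite -(sum_set_weight_supset (1 - q) D) (reindex_inj (@setC_inj E)) /=.
apply: eq_big => [F|F _]; first by rewrite disjoint_sym disjoints_subset setCK.
by apply: eq_bigr => e _; rewrite inE subKr; case: (e \in F).
Qed.

(** * The spread of a randomly coloured matching *)

Section MatchingColour.
Variables (R : realFieldType) (E C : finType).
Variables (good : pred {set E}) (m : {set E} -> C -> E) (q : R).

Definition coloured (F : {set E}) (sigma : {perm C}) : {set E * C} :=
  [set (m F i, sigma i) | i : C].

Definition good_prob : R := \sum_(F : {set E} | good F) set_weight q F.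

(** The law of [coloured F sigma] for a [q]-random [F] conditioned on [good] and an independent
    uniform [sigma]; [m F i] plays the [i]-th edge of a matching chosen in [F]. *)
Definition coloured_measure (X : {set E * C}) : R :=
  (\sum_(F : {set E} | good F) \sum_(sigma : {perm C} | coloured F sigma == X)
    set_weight q F) / (good_prob * #|C|`!%:R).

Hypothesis q01 : 0 <= q <= 1.
Hypothesis good_half : 2^-1 <= good_prob.
Hypothesis m_inj : forall F, good F -> injective (m F).
Hypothesis m_sub : forall F, good F -> forall i, m F i \in F.

Let den_gt0 : 0 < good_prob * #|C|`!%:R.
Proof.
rewrite mulr_gt0 ?ltr0n ?fact_gt0 //; apply: lt_le_trans good_half.
by rewrite invr_gt0.
Qed.

Lemma sum_coloured_measure (P : pred {set E * C}) :
  \sum_(X : {set E * C} | P X) coloured_measure X =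
  (\sum_(F : {set E} | good F) set_weight q F * #|[pred sigma | P (coloured F sigma)]|%:R)
    / (good_prob * #|C|`!%:R).
Proof.
rewrite -mulr_suml; congr (_ / _); rewrite exchange_big /=.
apply: eq_bigr => F _.
rewrite mulr_natr -sumr_const (partition_big (coloured F) P) //=.
by apply: eq_bigr => X PX; apply: eq_bigl => sigma; rewrite inE; case: eqP => [->|];
  rewrite ?andbF ?PX.
Qed.

Lemma mass_coloured_measure : mass coloured_measure = 1.
Proof.
rewrite /mass sum_coloured_measure.
have -> : \sum_(F : {set E} | good F) set_weight q F * #|[pred sigma : {perm C} |
  true]|%:R = good_prob * #|C|`!%:R.
  rewrite -mulr_suml; congr (_ * _%:R).
  rewrite -cardsT -card_perm; apply: eq_card => sigma; rewrite !inE.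
  by symmetry; apply/subsetP => x; rewrite inE.
by rewrite mulfV // gt_eqF.
Qed.

Lemma coloured_measure_neq0 X : coloured_measure X != 0 ->
  exists2 F, good F & exists sigma, X = coloured F sigma.
Proof.
move=> X0; have [[F sigma] /= /andP[gF /eqP <-]|none] := pickP
  (fun u : {set E} * {perm C} => good u.1 && (coloured u.1 u.2 == X)).
  by exists F => //; exists sigma.
move: X0; rewrite /coloured_measure big1 ?mul0r ?eqxx // => F gF.
by rewrite big_pred0 // => sigma; have := none (F, sigma); rewrite /= gF.
Qed.

Lemma card_coloured F sigma : good F -> #|coloured F sigma| = #|C|.
Proof. by move=> gF; rewrite card_imset // => i j [/(m_inj gF)]. Qed.

(** Containing [S] forces its [s] edges into [F], which has probability [q ^+ s], and prescribes
    [sigma] on [s] indices, which has probability at most [(4 / #|C|) ^+ s]. Conditioning costs a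
    factor 2, at most [2 ^+ s] for nonempty [S]. *)
Lemma coloured_measure_spread : spread (8 * q / #|C|%:R) coloured_measure.
Proof.
have w0 F : 0 <= set_weight q F by apply: set_weight_ge0.
split=> [X|S].
  rewrite divr_ge0 ?(ltW den_gt0) //; apply: sumr_ge0 => F _.
  by apply: sumr_ge0.
have [->|S0] := eqVneq S set0.
  rewrite cards0 expr0 -mass_coloured_measure /mass le_eqVlt; apply/orP; left.
  by apply/eqP/eq_bigl => X; rewrite sub0set.
rewrite sum_coloured_measure ler_pdivrMr //.
pose s := #|S|; pose S1 := [set x.1 | x in S].
(* If no coloured matching contains [S], the sum vanishes; otherwise one that does shows that the
   pairs of [S] have distinct edges and that [s <= #|C|]. *)
have [[[F0 sigma0] /= /andP[gF0 S_sub0]]|none] := pickP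
  (fun u : {set E} * {perm C} => good u.1 && (S \subset coloured u.1 u.2)); last first.
  rewrite big1 ?mulr_ge0 ?exprn_ge0 ?divr_ge0 ?mulr_ge0 ?(ltW den_gt0) //;
    first by case/andP: q01.
    by rewrite (le_trans _ good_half) // invr_ge0.
  move=> F gF; rewrite eq_card0 ?mulr0 // => sigma; rewrite inE.
  by have := none (F, sigma); rewrite /= gF.
have sC : (s <= #|C|)%N by rewrite -(card_coloured sigma0 gF0) subset_leq_card.
have C0 : (0 < #|C|)%N by rewrite (leq_trans _ sC) // card_gt0.
have S1s : #|S1| = s.
  rewrite card_in_imset // => x y /(subsetP S_sub0)/imsetP[i _ ->] /(subsetP
    S_sub0)/imsetP[j _ ->] /=.
  by move=> /(m_inj gF0) ->.
have step F : good F -> set_weight q F * #|[pred sigma | S \subset coloured F sigma]|%:R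
    <= (if S1 \subset F then set_weight q F else 0) * (#|C| - s)`!%:R.
  move=> gF; case: (pickP (fun sigma => S \subset coloured F sigma)) =>
    [sigma1 Ssub1|none]; last first.
    rewrite eq_card0 ?mulr0; last by move=> sigma; rewrite inE none.
    by rewrite mulr_ge0 //; case: ifP.
  have -> : S1 \subset F.
    apply/subsetP => _ /imsetP[x xS ->].
    by have /imsetP[i _ ->] := subsetP Ssub1 _ xS; apply: m_sub.
  rewrite ler_wpM2l // ler_nat.
  (* The indices whose colour is prescribed by [S]: as [m F] is injective, every admissible
     permutation agrees there with [sigma1]. *)
  pose D := [set i | (m F i, sigma1 i) \in S].
  have Ds : #|D| = s.
    rewrite -(card_imset _ (m_inj gF)) -S1s; congr #|pred_of_set _|; apply/setP => e.
    apply/imsetP/imsetP => [[i]|[x xS ->]].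
      by rewrite inE => iS ->; exists (m F i, sigma1 i).
    have /imsetP[i _ xE] := subsetP Ssub1 _ xS.
    by exists i; rewrite ?inE -?xE // xE.
  rewrite -Ds; apply: (@card_perm_agree _ _ sigma1) => sigma Ssub i.
  rewrite inE => /(subsetP Ssub)/imsetP[j _ [/(m_inj gF) <-]] //.
apply: (le_trans (ler_sum _ step)).
rewrite -mulr_suml.
have qs : \sum_(F | good F) (if S1 \subset F then set_weight q F else 0) <= q ^+ s.
  apply: (@le_trans _ _ (\sum_(F : {set E} | S1 \subset F) set_weight q F)).
    rewrite [leRHS]big_mkcond [leLHS]big_mkcond; apply: ler_sum => F _.
    by case: (good F) => //; case: ifP.
  by rewrite sum_set_weight_supset S1s.
apply: (@le_trans _ _ (q ^+ s * (#|C| - s)`!%:R)); first by rewrite ler_wpM2r.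
rewrite -/s expr_div_n exprMn.
have Cs0 : 0 < #|C|%:R ^+ s :> R by rewrite exprn_gt0 // ltr0n.
rewrite mulrAC -[in leRHS]mulrA [in leRHS]mulrCA [in leRHS]mulrC.
rewrite mulrAC ler_pdivlMr // -[leRHS]mulrA [leRHS]mulrC -!mulrA.
rewrite ler_wpM2l ?exprn_ge0 //; first by case/andP: q01.
have : ((#|C| - s)`! * #|C| ^ s <= 4 ^ s * #|C|`!)%N.
  rewrite -(ffact_fact sC) mulnA mulnC leq_mul2r expn_le_ffact ?orbT //.
rewrite -(ler_nat R) !natrM !natrX => H; apply: (le_trans H).
have -> : 8 ^+ s = 2 ^+ s * 4 ^+ s :> R by rewrite -exprMn; congr (_ ^+ _); ring.
have g0 : 1 <= good_prob * 2 ^+ s.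
  have s0 : (0 < s)%N by rewrite card_gt0.
  have : 2 <= 2 ^+ s :> R by rewrite -{1}[2]expr1 ler_weXn2l // ler1n.
  have := good_half; nra.
have f0 : 0 <= 4 ^+ s * #|C|`!%:R :> R by rewrite mulr_ge0 ?exprn_ge0.
nra.
Qed.

Lemma coloured_measure_bounded : support_bounded #|C| coloured_measure.
Proof.
by move=> X /coloured_measure_neq0[F gF [sigma ->]]; rewrite card_coloured.
Qed.

End MatchingColour.

(** * Balanced cuts of bijumbled graphs *)

Lemma exists_subset_card (T : finType) (A : {set T}) k : (k <= #|A|)%N ->
  exists2 S : {set T}, S \subset A & #|S| = k.
Proof.
move=> kA; have /card_gt0P[S] : (0 < #|[set S : {set T} | S \subset A & #|S| == k]|)%N.
  by rewrite cards_draws bin_gt0.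
by rewrite inE => /andP[SA /eqP Sk]; exists S.
Qed.

Section Graph.
Variables (T : finType) (G : sgraph T).
Implicit Types (A B S U X Y : {set T}).

Definition deg_in Y x : nat := (\sum_(y in Y) G x y)%N.

Lemma dir_edgesE X Y : dir_edges G X Y = (\sum_(x in X) deg_in Y x)%N.
Proof.
rewrite /dir_edges /deg_in pair_big_dep /= -sum1dep_card [LHS]big_mkcond [RHS]big_mkcond.
by apply: eq_bigr => -[x y] _; rewrite !inE /=; case: (x \in X); case: (y \in Y);
  case: (G x y).
Qed.

Lemma degreeE x : degree G x = deg_in [set: T] x.
Proof.
rewrite /degree /deg_in -sum1_card [LHS]big_mkcond [RHS]big_mkcond.
by apply: eq_bigr => y _; rewrite !inE; case: (G x y).
Qed.

Lemma deg_in_setD Y U x : U \subset Y ->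
  deg_in Y x = (deg_in U x + deg_in (Y :\: U) x)%N.
Proof. by move=> UY; rewrite /deg_in (big_setID U) /= (setIidPr UY). Qed.

Lemma dir_edges_setD X Y U : U \subset Y ->
  dir_edges G X Y = (dir_edges G X U + dir_edges G X (Y :\: U))%N.
Proof.
move=> UY; rewrite !dir_edgesE -big_split /=.
by apply: eq_bigr => x _; apply: deg_in_setD.
Qed.

Lemma min_degree_le x : (min_degree G <= degree G x)%N.
Proof.
rewrite /min_degree; have := mem_index_enum x.
elim: (index_enum T) => // y s IH; rewrite inE big_cons => /orP[/eqP <-|/IH].
  exact: geq_minl.
by apply: leq_trans; apply: geq_minr.
Qed.

(** Local optimality of the cut under exchanging [u] and [v], rewritten with full degrees; an edge
    between [u] and [v], which crosses before and after, only adds slack. *)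
Definition swap_stable A B :=
  forall u v, u \in A -> v \in B ->
    (degree G u + degree G v <= 2 * (deg_in B u + deg_in A v))%N.

Lemma swap_stableC A B : swap_stable A B -> swap_stable B A.
Proof. by move=> st u v uB vA; have := st v u vA uB; lia. Qed.

(* The witness is a balanced cut with the largest number of crossing edges. *)
Lemma exists_swap_stable m : #|T| = m.*2 -> exists A,
  [/\ #|A| = m, #|~: A| = m & swap_stable A (~: A)].
Proof.
move=> Tm; have /exists_subset_card[A0 _ A0m] : (m <= #|[set: T]|)%N.
  by rewrite cardsT Tm -addnn leq_addr.
case: (@arg_maxnP _ A0 (fun A => #|A| == m) (fun A => dir_edges G A (~: A))).
  exact/eqP.
move=> A /eqP Am Amax; exists A; split=> //; first by rewrite cardsCs setCK Tm Am; lia.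
move=> u v uA; rewrite inE => vA.
have uv : u != v by apply: contraNneq vA => <-.
pose A1 := A :\ u; pose B1 := ~: A :\ v; pose A' := v |: A1.
have vA1 : v \notin A1 by rewrite !inE (negPf vA) andbF.
have A'm : #|A'| == m by rewrite cardsU1 vA1 -Am (cardsD1 u A) uA.
have := Amax _ A'm.
have CA' : ~: A' = u |: B1.
  apply/setP => x; rewrite !inE negb_or negb_and negbK.
  by have [->|xu] := eqVneq x u; rewrite ?uv /= ?orbF.
have uB1 : u \notin B1 by rewrite !inE uA andbF.
have Guu x : G x x = false by apply: adj_irrefl.
have split_v x : deg_in (~: A) x = (G x v + deg_in B1 x)%N.
  by rewrite /deg_in (big_setD1 v) ?inE //.
have split_u x : deg_in A x = (G x u + deg_in A1 x)%N.
  by rewrite /deg_in (big_setD1 u).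
have sumG Y x : (\sum_(y in Y) G y x = deg_in Y x)%N.
  by apply: eq_bigr => y _; rewrite adj_sym.
have cutA : dir_edges G A (~: A) = (G u v + deg_in B1 u + (deg_in A1 v + dir_edges G A1
  B1))%N.
  rewrite dir_edgesE (big_setD1 u) //= split_v; congr (_ + _)%N.
  by rewrite (eq_bigr _ (fun x _ => split_v x)) big_split /= sumG dir_edgesE.
have cutA' : dir_edges G A' (~: A') = (G v u + deg_in B1 v + (deg_in A1 u + dir_edges G
  A1 B1))%N.
  rewrite dir_edgesE CA' big_setU1 //=; congr (_ + _)%N.
    by rewrite /deg_in big_setU1.
  rewrite dir_edgesE -sumG -big_split /=; apply: eq_bigr => x _.
  by rewrite /deg_in big_setU1.
rewrite cutA cutA' (adj_sym _ v u) !degreeE !(deg_in_setD _ (subsetT A)) !setTD.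
rewrite (split_v u) (split_v v) (split_u u) (split_u v) !Guu (adj_sym _ v u).
by lia.
Qed.

End Graph.

Section Bijumbled.
Variables (R : realType) (T : finType) (G : sgraph T).
Implicit Types (A B S U X Y : {set T}).
Variables (p beta : R) (m : nat).
Hypothesis Tm : #|T| = m.*2.
Hypothesis jumbled : bijumbled G p beta.
Hypothesis beta_ge0 : 0 <= beta.
Hypothesis p_gt0 : 0 < p.
Let n : R := #|T|%:R.

Let n2m : n = 2 * m%:R.
Proof. by rewrite /n Tm -muln2 natrM mulrC. Qed.

Let sqrt_card X Y : Num.sqrt (#|X|%:R * #|Y|%:R) <= n.
Proof.
rewrite -[leRHS]ger0_norm ?ler0n // -sqrtr_sqr ler_sqrt ?sqr_ge0 // expr2.
by apply: ler_pM; rewrite ?ler0n // ler_nat max_card.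
Qed.

Lemma dir_edges_le X Y :
  (dir_edges G X Y)%:R <= p * #|X|%:R * #|Y|%:R + beta * Num.sqrt (#|X|%:R * #|Y|%:R).
Proof. by have := jumbled X Y; rewrite ler_norml => /andP[_]; lra. Qed.

Lemma dir_edges_ge X Y :
  p * #|X|%:R * #|Y|%:R - beta * n <= (dir_edges G X Y)%:R.
Proof.
have := jumbled X Y; rewrite ler_norml => /andP[+ _].
have := ler_wpM2l beta_ge0 (sqrt_card X Y); lra.
Qed.

Variable c : R.
Hypothesis c_gt0 : 0 < c.
Hypothesis c_le1 : c <= 1.
Hypothesis deg_ge : forall x, c * p * n <= (degree G x)%:R.
Hypothesis beta_le : beta <= c / 128 * p * n.

(* If u had few neighbours across, all vertices of B would have too many. *)
Lemma swap_stable_deg A B : (0 < m)%N -> #|A| = m -> #|B| = m -> swap_stable G A B ->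
  forall u, u \in A -> c * p * n <= 4 * (deg_in G B u)%:R.
Proof.
move=> m0 Am Bm st u uA; rewrite leNgt; apply/negP => small.
have m0R : 0 < m%:R :> R by rewrite ltr0n.
have n0 : 0 < n by rewrite n2m mulr_gt0.
have degB v : v \in B -> (degree G v)%:R + c * p * n / 2 <= 2 * (deg_in G A v)%:R.
  move=> vB; have := st u v uA vB; rewrite -(ler_nat R) natrD natrM natrD.
  have := deg_ge u; lra.
(* Twice the edges from [B] to [A] exceed those from [B] to all vertices by [c * p * n * m / 2],
   whereas bijumbledness allows an excess of at most [3 * beta * n], that is
   [3 / 64 * c * p * n * m]. *)
have : \sum_(v in B) ((degree G v)%:R + c * p * n / 2) <=
       \sum_(v in B) 2 * (deg_in G A v)%:R by apply: ler_sum.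
rewrite big_split /= sumr_const -mulr_sumr -!natr_sum -dir_edgesE.
rewrite (eq_bigr _ (fun x _ => degreeE G x)) -dir_edgesE Bm -mulr_natr.
have := dir_edges_ge B [set: T]; have := dir_edges_le B A.
have := ler_wpM2l beta_ge0 (sqrt_card B A).
rewrite cardsT -/n Am Bm => h1 h2 h3.
have cpn : 0 < c * p * n by rewrite !mulr_gt0.
have cpnm : 0 < c * p * n * m%:R by rewrite mulr_gt0.
have hb : beta * n <= c / 128 * p * n * n by rewrite ler_wpM2r // ltW.
have e1 : p * m%:R * n = 2 * (p * m%:R * m%:R) by rewrite n2m; ring.
have e2 : c / 128 * p * n * n = c * p * n * m%:R / 64 by rewrite {2}n2m; field.
by move: h1 h2 h3 hb e1 e2 cpnm; rewrite mulrAC; lra.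
Qed.

(** For small [S] the crossing degrees decide, since few edges fit between [S] and [U]; for larger
    [S] bijumbledness between [S] and [B :\: U] suffices. *)
Lemma expansion A B S U : (0 < m)%N -> #|A| = m -> #|B| = m ->
  (forall u, u \in A -> c * p * n <= 4 * (deg_in G B u)%:R) ->
  S \subset A -> U \subset B -> (#|U| < #|S|)%N -> (2 * #|S| <= m.+1)%N ->
  c / 8 * p * n * #|S|%:R <= (dir_edges G S (B :\: U))%:R.
Proof.
move=> m0 Am Bm degB SA UB US Sm.
have m0R : 0 < m%:R :> R by rewrite ltr0n.
have n0 : 0 < n by rewrite n2m mulr_gt0.
have pn0 : 0 < p * n by rewrite mulr_gt0.
have USR : #|U|%:R <= #|S|%:R :> R by rewrite ler_nat ltnW.
(* Below this threshold at most [(c / 16 + c / 128) * p * n * #|S|] edges go into [U], out of at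
   least [c / 4 * p * n * #|S|]. *)
have [small|large] := leP #|S|%:R (c / 16 * n).
  have : (dir_edges G S B)%:R = (dir_edges G S U)%:R + (dir_edges G S (B :\: U))%:R :> R.
    by rewrite -natrD -dir_edges_setD.
  have : c * p * n * #|S|%:R <= 4 * (dir_edges G S B)%:R.
    rewrite dir_edgesE natr_sum mulr_sumr mulr_natr -sumr_const.
    by apply: ler_sum => x xS; apply: degB; apply: subsetP xS.
  have : (dir_edges G S U)%:R <= (p * #|S|%:R + beta) * #|S|%:R.
    apply: (le_trans (dir_edges_le S U)); rewrite mulrDl; apply: lerD.
      by rewrite ler_wpM2l // mulr_ge0 // ltW.
    rewrite ler_wpM2l // -[leRHS]ger0_norm ?ler0n // -sqrtr_sqr ler_sqrt ?sqr_ge0 //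
      expr2.
    by rewrite ler_wpM2l.
  have : (p * #|S|%:R + beta) * #|S|%:R <= (c / 16 * p * n + c / 128 * p * n) * #|S|%:R.
    have : p * #|S|%:R <= p * (c / 16 * n) by rewrite ler_wpM2l // ltW.
    by move=> h; rewrite ler_wpM2r // lerD //; move: h; lra.
  have : 0 <= c * p * n * #|S|%:R by rewrite !mulr_ge0 // ?ltW.
  lra.
(* From [#|U| < #|S|] and [2 * #|S| <= m.+1], the set [U] misses at least half of [B]. *)
have BU : n <= 4 * #|B :\: U|%:R.
  have : (m.*2 <= 4 * #|B :\: U|)%N by rewrite cardsD (setIidPr UB) Bm; lia.
  by rewrite -(ler_nat R) -Tm natrM.
have := dir_edges_ge S (B :\: U).
have h1 : p * #|S|%:R * n <= p * #|S|%:R * (4 * #|B :\: U|%:R).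
  by rewrite ler_wpM2l // mulr_ge0 // ltW.
have h2 : beta * n <= c / 128 * p * n * n by rewrite ler_wpM2r // ltW.
have h3 : p * n * (c / 16 * n) <= p * n * #|S|%:R by rewrite ler_wpM2l // ltW.
have h4 : c * (p * n * #|S|%:R) <= 1 * (p * n * #|S|%:R).
  by rewrite ler_wpM2r // mulr_ge0 // ltW.
lra.
Qed.

End Bijumbled.

(** * Crossing perfect matchings in the percolation *)

Lemma sum_expr_card (R : comNzRingType) (T : finType) (y : R) :
  \sum_(S : {set T}) y ^+ #|S| = (1 + y) ^+ #|T|.
Proof.
have <- : \prod_(x : T) (y + 1) = (1 + y) ^+ #|T| by rewrite prodr_const addrC.
rewrite bigA_distr; apply: eq_bigr => S _.
by rewrite -big_mkcondr /= prodr_const.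
Qed.

Section Crossing.
Variables (T : finType) (G : sgraph T).
Implicit Types (A B S U Y : {set T}) (F : {set edge G}).

Definition joined F x y : bool := [exists e in F, val e == [set x; y]].

Definition cut_edges S U : {set edge G} :=
  [set e | [exists x in S, exists y in U, val e == [set x; y]]].

(** The matching is a finite function on all of [T], arbitrary outside [A], so that its existence is
    a boolean. *)
Definition crossing_pm A F (f : {ffun T -> T}) : bool :=
  dinjectiveb f (mem A) && [forall x in A, (f x \notin A) && joined F x (f x)].

Definition has_crossing_pm A F : bool := [exists f, crossing_pm A F f].

Lemma joinedC F x y : joined F x y = joined F y x.
Proof. by rewrite /joined setUC. Qed.

Lemma cut_edges_disjoint F S U :
  (forall x y, x \in S -> y \in U -> ~~ joined F x y) -> [disjoint F & cut_edges S U].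
Proof.
move=> noFSU; rewrite -setI_eq0 -subset0; apply/subsetP => e.
rewrite !inE => /andP[eF /exists_inP[x xS /exists_inP[y yU exy]]].
by have /negP[] := noFSU x y xS yU; apply/exists_inP; exists e.
Qed.

Lemma card_cut_edges S U : [disjoint S & U] ->
  (dir_edges G S U <= #|cut_edges S U|)%N.
Proof.
move=> dSU; rewrite -(card_imset _ val_inj) /dir_edges.
have SU x : x \in S -> x \in U -> False.
  by move=> xS xU; have /pred0P/(_ x) := dSU; rewrite /= xS xU.
rewrite -(@card_in_imset _ _ (fun xy : T * T => [set xy.1; xy.2])).
  apply: subset_leq_card; apply/subsetP => _ /imsetP[[x y] + ->].
  rewrite !inE /= => /andP[/andP[xS yU] Gxy].
  have exy : [set x; y] \in edges G.
    by rewrite inE; apply/existsP; exists x; apply/existsP; exists y; rewrite Gxy eqxx.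
  apply/imsetP; exists (exist _ [set x; y] exy) => //.
  by rewrite inE; apply/exists_inP; exists x => //; apply/exists_inP; exists y.
move=> [x y] [x' y']; rewrite !inE /= =>
  /andP[/andP[xS yU] _] /andP[/andP[x'S y'U] _] /setP E.
have := E x; rewrite !inE eqxx /= => /esym/orP[/eqP xx'|/eqP xy'];
  last by case: (SU x); rewrite // xy'.
have := E y; rewrite !inE eqxx orbT => /esym/orP[/eqP yx'|/eqP yy'];
  last by rewrite xx' yy'.
by case: (SU y); rewrite // yx'.
Qed.

Definition violator m Y S U : bool :=
  [&& S \subset ~: Y, U \subset Y, #|U| < #|S| & 2 * #|S| <= m.+1]%N.

(** Hall's theorem gives a violator in [A]; one that exceeds half the side is traded for a small one
    on the other side. *)
Lemma no_crossing_pm m A F : #|A| = m -> #|~: A| = m -> (0 < m)%N ->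
  ~~ has_crossing_pm A F ->
  exists Y S U, [/\ Y = A \/ Y = ~: A, violator m Y S U
    & [disjoint F & cut_edges S (Y :\: U)]].
Proof.
move=> Am Bm m0 nopm.
have [y0 _] : exists y0 : T, y0 \in A by apply/card_gt0P; rewrite Am.
pose g x y := (y \notin A) && joined F x y.
have [/forallP allS|/forallPn[S]] := boolP [forall S : {set T},
  (S \subset A) ==> (#|S| <= #|nbrs g S|)%N].
  have [S SA|f [finj fg]] := @Hall _ _ y0 g A; first by have /implyP := allS S; apply.
  case/negP: nopm; apply/existsP; exists (finfun f); apply/andP; split.
    by apply/dinjectiveP => x x' xA x'A; rewrite !ffunE; apply: finj.
  by apply/forall_inP => x xA; rewrite ffunE; apply: fg.
rewrite negb_imply -ltnNge => /andP[SA NS].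
have NB : nbrs g S \subset ~: A by apply/subsetP => y /nbrsP[x _ /andP[yA _]];
  rewrite inE.
have noFS x y : x \in S -> y \in ~: A :\: nbrs g S -> ~~ joined F x y.
  move=> xS; rewrite inE => /andP[/nbrsP noN]; rewrite inE => yA; apply/negP => Fxy.
  by apply: noN; exists x => //; rewrite /g yA.
have [Sm|Sm] := leqP (2 * #|S|) m.+1.
  exists (~: A), S, (nbrs g S); split; first by right.
    by rewrite /violator setCK SA NB NS Sm.
  exact: cut_edges_disjoint.
have SAm : (#|S| <= m)%N by rewrite -Am subset_leq_card.
(* The vertices across that [S] does not reach are joined within [A] only to [A :\: S], of size
   [m - #|S|]; one vertex more than that makes a violator. *)
have [S' S'B S'm] : exists2 S' : {set T},
  S' \subset ~: A :\: nbrs g S & #|S'| = (m - #|S|).+1.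
  by apply: exists_subset_card; rewrite cardsD (setIidPr NB) Bm; lia.
exists A, S', (A :\: S); split; first by left.
  rewrite /violator (subset_trans S'B (subsetDl _ _)) subsetDl S'm cardsD (setIidPr SA)
    Am ltnSn /=.
  by lia.
rewrite setDDr setDv set0U (setIidPr SA); apply: cut_edges_disjoint => x y xS' yS.
by rewrite joinedC noFS // (subsetP S'B).
Qed.

Variable R : realType.

Lemma one_sub_expr_le (q : R) k : 0 <= q <= 1 -> (1 - q) ^+ k <= expR (- (q * k%:R)).
Proof.
move=> /andP[q0 q1]; rewrite -mulNr expRM_natr lerXn2r ?nnegrE ?expR_ge0 ?subr_ge0 //.
exact: expR_ge1Dx.
Qed.

(** A union bound over the violators: a cut of at least [d * #|S|] edges is missed with probability
    at most [n ^- (8 * #|S|)]. *)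
Lemma crossing_pm_prob (m : nat) (q d : R) A : #|A| = m -> #|~: A| = m -> (0 < m)%N ->
  0 <= q <= 1 -> 8 * ln #|T|%:R <= q * d ->
  (forall Y S U, Y = A \/ Y = ~: A -> violator m Y S U ->
     d * #|S|%:R <= (dir_edges G S (Y :\: U))%:R) ->
  2^-1 <= good_prob (has_crossing_pm A) q.
Proof.
move=> Am Bm m0 q01 qd exp; have /andP[q0 q1] := q01.
have w0 (F : {set edge G}) : 0 <= set_weight q F by apply: set_weight_ge0.
(* For [n >= 2] this gives [n ^- 8 <= y ^+ 2]. As [U] is smaller than [S], the bound splits into
   [y ^+ #|S| * y ^+ #|U|], and the sums over all sets become powers of [1 + y]. *)
pose n : R := #|T|%:R; pose y : R := (8 * n)^-1.
have n2 : 2 <= n.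
  by rewrite ler_nat -cardsT -(setUCr A) cardsU setICr cards0 Am Bm; lia.
have n0 : 0 < n by lra.
have y0 : 0 <= y by rewrite invr_ge0; lra.
have y1 : y <= 1 by rewrite invf_le1; lra.
have cutP Y S U : Y = A \/ Y = ~: A -> violator m Y S U ->
    (1 - q) ^+ #|cut_edges S (Y :\: U)| <= y ^+ #|S| * y ^+ #|U|.
  move=> YA vio; have /and4P[SY UY US Sm] := vio.
  have dS : [disjoint S & Y :\: U].
    by rewrite disjoints_subset (subset_trans SY) // setCS subsetDl.
  have cutS : d * #|S|%:R <= #|cut_edges S (Y :\: U)|%:R.
    by apply: (le_trans (exp Y S U YA vio)); rewrite ler_nat card_cut_edges.
  apply: (le_trans (one_sub_expr_le _ q01)).
  apply: (@le_trans _ _ ((y ^+ 2) ^+ #|S|)); last first.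
    rewrite -exprM mulSn mul1n exprD ler_wpM2l ?exprn_ge0 //.
    by rewrite ler_wiXn2l // ltnW.
  apply: (@le_trans _ _ (expR (- (8 * ln n)) ^+ #|S|)).
    rewrite -expRM_natr ler_expR mulNr lerN2.
    apply: (@le_trans _ _ (q * d * #|S|%:R)); first by rewrite ler_wpM2r.
    by rewrite -mulrA ler_wpM2l.
  rewrite lerXn2r ?nnegrE ?expR_ge0 ?exprn_ge0 //.
  rewrite expRN expRM_natl lnK ?posrE //.
  have : 64 <= n ^+ 6.
    have -> : 64 = 2 ^+ 6 :> R by ring.
    by rewrite lerXn2r ?nnegrE // ltW.
  rewrite /y exprVn => n6; rewrite lef_pV2 ?posrE ?exprn_gt0 ?mulr_gt0 //.
  have -> : (8 * n) ^+ 2 = 64 * n ^+ 2 by ring.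
  by have -> : n ^+ 8 = n ^+ 6 * n ^+ 2; [ring | rewrite ler_wpM2r // exprn_ge0 // ltW].
have total : good_prob (has_crossing_pm A) q + \sum_(F |
  ~~ has_crossing_pm A F) set_weight q F = 1.
  by rewrite /good_prob -(sum_set_weight (edge G) q) [RHS](bigID (has_crossing_pm A)).
pose side (b : bool) := if b then A else ~: A.
have sideP b : side b = A \/ side b = ~: A by rewrite /side; case: b; [left | right].
have bad : \sum_(F | ~~ has_crossing_pm A F) set_weight q F <=
    \sum_(b : bool) \sum_(S : {set T} |
      S != set0) \sum_(U : {set T}) y ^+ #|S| * y ^+ #|U|.
  apply: (@le_trans _ _ (\sum_(b : bool) \sum_(S : {set T} |
    S != set0) \sum_(U : {set T} | violator m (side b) S U)
     \sum_(F : {set edge G} | [disjoint F & cut_edges S (side b :\: U)]) set_weight q F)).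
    pose ok F b S U := violator m (side b) S U && [disjoint F & cut_edges S (side b :\:
      U)].
    have -> : \sum_(b : bool) \sum_(S : {set T} | S != set0) \sum_(U : {set T} |
      violator m (side b) S U)
       \sum_(F : {set edge G} | [disjoint F & cut_edges S (side b :\: U)]) set_weight q
         F =
       \sum_(F : {set edge G}) \sum_(b : bool) \sum_(S : {set T} |
         S != set0) \sum_(U : {set T})
         (if ok F b S U then set_weight q F else 0).
      rewrite [RHS]exchange_big /=; apply: eq_bigr => b _.
      rewrite [RHS]exchange_big /=; apply: eq_bigr => S _.
      rewrite [RHS]exchange_big /= [LHS]big_mkcond /=; apply: eq_bigr => U _.
      rewrite /ok; case: (violator _ _ _ _) => /=; last by rewrite big1.
      by rewrite big_mkcond.
    rewrite big_mkcond; apply: ler_sum => F _.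
    have term0 b S U : 0 <= (if ok F b S U then set_weight q F else 0) by case: ifP.
    case: ifP => [nopm|_]; last by do 3!apply: sumr_ge0 => ? _.
    have [Y [S [U [YA vio dis]]]] := no_crossing_pm Am Bm m0 nopm.
    have [b sb] : exists b, Y = side b by case: YA => ->; [exists true | exists false].
    have S0 : S != set0 by have /and4P[_ _ US _] := vio;
      rewrite -card_gt0 (leq_ltn_trans _ US).
    rewrite (bigD1 b) //= (bigD1 S) //= (bigD1 U) //= /ok -sb vio dis /= -!addrA lerDl.
    by apply: addr_ge0; [|apply: addr_ge0]; repeat (apply: sumr_ge0 => ? _); case: ifP.
  apply: ler_sum => b _; apply: ler_sum => S S0; rewrite big_mkcond.
  apply: ler_sum => U _; case: ifP => [vio|_]; last by rewrite mulr_ge0 ?exprn_ge0.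
  by rewrite sum_set_weight_disjoint cutP.
pose Z : R := (1 + y) ^+ #|T|.
have badE : \sum_(b : bool) \sum_(S : {set T} |
  S != set0) \sum_(U : {set T}) y ^+ #|S| * y ^+ #|U| =
    2 * ((Z - 1) * Z).
  rewrite sumr_const card_bool -[LHS]mulr_natl; congr (_ * _).
  rewrite (eq_bigr _ (fun S _ => esym (mulr_sumr _ _ _ _))) -mulr_suml sum_expr_card;
    congr (_ * _).
  by rewrite /Z -sum_expr_card [in RHS](bigD1 set0) //= cards0 expr0 addrC addrK.
have Z1 : 1 <= Z by rewrite exprn_ege1 // lerDl.
(* As [y * n = 8^-1], [Z] is at most [expR 8^-1]; the failure probability is then at most
   [2 * (1 / 7) * (8 / 7)], below one half. *)
have Z87 : Z <= 8 / 7.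
  apply: (@le_trans _ _ (expR y ^+ #|T|)).
    by rewrite lerXn2r ?nnegrE ?expR_ge0 ?expR_ge1Dx // addr_ge0.
  rewrite -expRM_natr -/n.
  have -> : y * n = 8^-1 by rewrite /y; field; rewrite gt_eqF.
  have := expR_ge1Dx (- 8^-1 : R); rewrite expRN => h.
  have e0 : 0 < expR (8^-1 : R) by apply: expR_gt0.
  have : 7 / 8 <= (expR 8^-1)^-1 :> R by apply: le_trans h; lra.
  by rewrite -[(expR _)^-1]mul1r ler_pdivlMr //; lra.
have Z0 : 0 <= Z by apply: le_trans Z1.
have : (Z - 1) * Z <= (8 / 7 - 1) * (8 / 7).
  by apply: ler_pM; rewrite ?subr_ge0 ?lerD2r.
rewrite badE in bad; move: total bad; lra.
Qed.

End Crossing.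

(** * The rainbow perfect matching *)

(** If [W1 :|: W2] contains a member [X] of the support and [W2] contains none, then [X] uses a pair
    of [W1], and only one because they all share the edge [e]; the term of this pair is 1. *)
Lemma hits_one_colour (R : realFieldType) (E C : finType) (lam : {set E * C} -> R) :
  (forall X, lam X != 0 -> {in X &, injective fst}) ->
  one_colour_subadditive (fun W => (hits lam W)%:R : R).
Proof.
move=> lam1 e W1 W2 W1e.
have mono x : (hits lam W2)%:R <= (hits lam (x |: W2))%:R :> R.
  by apply: (hits_mono lam); apply: subsetUr.
have sum0 (P : pred (E * C)) : 0 <= \sum_(x |
  P x) ((hits lam (x |: W2))%:R - (hits lam W2)%:R) :> R.
  by apply: sumr_ge0 => x _; rewrite subr_ge0.
have [/existsP[X /andP[lX /subsetP XW]]|_] := boolP (hits lam (W1 :|: W2)); last first.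
  by rewrite addr_ge0 // ler0n.
have [h2|h2] := boolP (hits lam W2); first by have := sum0 (mem W1); rewrite h2; lra.
have /subsetPn[x xX xW2] : ~~ (X \subset W2).
  by apply: contra h2 => XW2; apply/existsP; exists X; rewrite lX.
have xW1 : x \in W1 by have := XW x xX; rewrite inE (negPf xW2) orbF.
have -> : true%:R = (hits lam (x |: W2))%:R :> R.
  suff -> : hits lam (x |: W2) by [].
  apply/existsP; exists X; rewrite lX; apply/subsetP => z zX.
  have := XW z zX; rewrite !inE => /orP[zW1|->]; last by rewrite orbT.
  by rewrite (lam1 _ lX z x) ?eqxx // !W1e.
rewrite (bigD1 x) //= subr0 add0r lerDl.
by apply: sumr_ge0 => z _; rewrite subr_ge0 ler0n.
Qed.

Lemma enum_prod (E C : finType) : enum {: E * C} = allpairs pair (enum E) (enum C).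
Proof. by rewrite [LHS]enumT -[RHS]/(prod_enum E C) unlock. Qed.

Section Assembly.
Variables (T : finType) (G : sgraph T) (Q : nat) (A : {set T}) (alpha : 'I_Q -> T).
Hypotheses (alpha_inj : injective alpha) (alphaA : forall i, alpha i \in A).
Hypotheses (Am : #|A| = Q) (Bm : #|~: A| = Q).
Variables (f : {ffun T -> T}) (mt : 'I_Q -> edge G).
Hypothesis f_inj : {in A &, injective f}.
Hypothesis fA : forall x, x \in A -> f x \notin A.
Hypothesis mtE : forall i, val (mt i) = [set alpha i; f (alpha i)].

Let alpha_surj x : x \in A -> exists i, alpha i = x.
Proof.
have /setP/(_ x) : alpha @: [set: 'I_Q] = A.
  apply/eqP; rewrite eqEcard card_imset // cardsT card_ord Am leqnn andbT.
  by apply/subsetP => _ /imsetP[i _ ->].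
by move=> <- /imsetP[i _ ->]; exists i.
Qed.

Lemma crossing_edges_inj : injective mt.
Proof.
move=> i j /(congr1 val); rewrite !mtE => /setP/(_ (alpha i)).
rewrite !inE eqxx /= => /esym/orP[/eqP/alpha_inj //|/eqP E].
by have := fA (alphaA j); rewrite -E alphaA.
Qed.

Lemma crossing_perfect_matching : perfect_matching [set mt i | i : 'I_Q].
Proof.
have fB : f @: A = ~: A.
  apply/eqP; rewrite eqEcard card_in_imset // Am Bm leqnn andbT.
  by apply/subsetP => _ /imsetP[x xA ->]; rewrite inE fA.
rewrite /perfect_matching /partition; apply/and3P; split.
- rewrite eqEsubset subsetT; apply/subsetP => x _.
  have inM i : [set alpha i; f (alpha i)] \in [set val e | e in [set mt i | i : 'I_Q]].
    by rewrite -mtE; apply: imset_f; apply: imset_f.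
  have [/alpha_surj[i <-]|] := boolP (x \in A).
    by apply/bigcupP; exists [set alpha i; f (alpha i)]; rewrite // !inE eqxx.
  rewrite -in_setC -fB => /imsetP[_ /alpha_surj[i <-] ->].
  by apply/bigcupP; exists [set alpha i; f (alpha i)]; rewrite // !inE eqxx orbT.
- apply/trivIsetP => _ _ /imsetP[_ /imsetP[i _ ->] ->] /imsetP[_ /imsetP[j _ ->] ->].
  rewrite !mtE => ij; have {}ij : i != j by apply: contraNneq ij => ->.
  rewrite -setI_eq0; apply/eqP/setP => x; rewrite !inE; apply/negP.
  move=> /andP[/orP[]/eqP-> /orP[]/eqP E].
  + by rewrite (alpha_inj E) eqxx in ij.
  + by have := fA (alphaA j); rewrite -E alphaA.
  + by have := fA (alphaA i); rewrite E alphaA.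
  + by rewrite (alpha_inj (f_inj (alphaA i) (alphaA j) E)) eqxx in ij.
apply/negP => /imsetP[_ /imsetP[i _ ->]]; rewrite mtE => /setP/(_ (alpha i)).
by rewrite !inE eqxx.
Qed.

Lemma coloured_has_rainbow_pm (sigma : {perm 'I_Q}) (chi : {ffun edge G -> 'I_Q}) (F :
  {set edge G}) :
  [set (mt i, sigma i) | i : 'I_Q] \subset [set (e, chi e) | e in F] ->
  has_rainbow_pm chi F.
Proof.
move=> /subsetP sub.
have mtF i : mt i \in F /\ chi (mt i) = sigma i.
  have /imsetP[e eF [-> ->]] : (mt i, sigma i) \in [set (e, chi e) | e in F].
    by apply: sub; apply: imset_f.
  by [].
apply/existsP; exists [set mt i | i : 'I_Q]; apply/and3P; split.
- by apply/subsetP => _ /imsetP[i _ ->]; case: (mtF i).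
- exact: crossing_perfect_matching.
apply/dinjectiveP => _ _ /imsetP[i _ ->] /imsetP[j _ ->].
by rewrite (mtF i).2 (mtF j).2 => /perm_inj ->.
Qed.

End Assembly.

Section Probability.
Variables (R : realType) (T : finType) (G : sgraph T).

(** [percolation_weight] unfolds to [set_weight], which identifies the exclusive colouring with the
    probability space of the theorem. *)
Lemma prob_colour_perc_expect (Q : nat) (rho : R) (f : {set edge G * 'I_Q} -> R)
    (P : {ffun edge G -> 'I_Q} -> {set edge G} -> bool) :
  (0 < Q)%N -> 0 <= rho <= 1 ->
  (forall (chi : {ffun edge G -> 'I_Q}) (F : {set edge G}), f [set (e, chi e) |
    e in F] <= (P chi F)%:R) ->
  expect_colour (enum (edge G)) rho f <= prob_colour_perc rho P.
Proof.
move=> Q0 rho01 fP; rewrite expect_colour_weight ?card_ord //.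
apply: ler_sum => chi _; rewrite [leRHS]big_mkcond; apply: ler_sum => F _.
have w0 : 0 <= colouring_weight R chi * percolation_weight rho F.
  by apply: mulr_ge0; [apply: prodr_ge0 => e _; rewrite invr_ge0 | exact: set_weight_ge0].
apply: (le_trans (ler_wpM2l w0 (fP chi F))).
by case: (P chi F); rewrite ?mulr1 ?mulr0.
Qed.

Lemma prob_colour_perc_le1 (Q : nat) (rho : R) (P : {ffun edge G -> 'I_Q} -> {set edge
  G} -> bool) :
  (0 < Q)%N -> 0 <= rho <= 1 -> prob_colour_perc rho P <= 1.
Proof.
move=> Q0 rho01; apply: (@le_trans _ _ (\sum_(chi : {ffun edge G -> 'I_Q})
  colouring_weight R chi)).
  apply: ler_sum => chi _; rewrite big_mkcond -[leRHS]mulr1 -(sum_set_weight (edge G)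
    rho) mulr_sumr.
  apply: ler_sum => F _; have w0 : 0 <= colouring_weight R chi * set_weight rho F.
    by apply: mulr_ge0; [apply: prodr_ge0 => e _;
      rewrite invr_ge0 | exact: set_weight_ge0].
  by case: ifP.
rewrite sumr_const card_ffun card_ord /colouring_weight prodr_const -[leLHS]mulr_natl
  natrX -exprMn.
by rewrite mulfV ?expr1n // pnatr_eq0 -lt0n.
Qed.

End Probability.

(** * The explicit bound for a fixed graph *)

Lemma ln2_ge_half (R : realType) : 2^-1 <= ln 2 :> R.
Proof.
rewrite -ler_expR lnK ?posrE //.
have := expR_ge1Dx (- 2^-1 : R); rewrite expRN => h.
have e0 : 0 < expR (2^-1 : R) by apply: expR_gt0.
have : 2^-1 <= (expR 2^-1)^-1 :> R by apply: le_trans h; lra.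
by rewrite lef_pV2 ?posrE.
Qed.

Lemma trunc_log_le_ln (R : realType) n : (0 < n)%N -> (trunc_log 2 n)%:R <= 2 * ln n%:R
  :> R.
Proof.
move=> n0; have h : ln (2 ^+ trunc_log 2 n) <= ln n%:R :> R.
  by rewrite ler_ln ?posrE ?exprn_gt0 ?ltr0n // -natrX ler_nat trunc_logP.
rewrite lnXn // -[X in X <= _]mulr_natl in h.
have := ler_wpM2l (ler0n R (trunc_log 2 n)) (ln2_ge_half R); lra.
Qed.

Section FiniteBound.
Variables (R : realType) (T : finType) (G : sgraph T) (Q : nat).
Variables (c p beta rho : R).
Let n : R := #|T|%:R.

(** With [k = trunc_log 2 #|T|], [k] halving rounds bring the support down to size [s] and the last
    round takes [L = k]; [s] stays free, to be chosen from the target error. *)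
Lemma rainbow_pm_prob_ge (s : nat) :
  #|T| = Q.*2 -> (0 < Q)%N -> 0 < c <= 1 -> 0 < p -> 0 <= beta -> 0 < rho <= 1 ->
  bijumbled G p beta -> c * p * n <= (min_degree G)%:R ->
  beta <= c / 128 * p * n -> 260 * 256 / c * ln n ^+ 2 <= rho * p * n ->
  (0 < s <= trunc_log 2 #|T|)%N ->
  1 - (s%:R ^+ 2 / (trunc_log 2 #|T|)%:R + 2 * 16^-1 ^+ s) <=
    prob_colour_perc rho (@has_rainbow_pm T G Q).
Proof.
move=> Tm Q0 /andP[c0 c1] p0 beta0 /andP[rho0 rho1] jumbled min_deg beta_le rho_ge
  /andP[s0 sk].
have rho01 : 0 <= rho <= 1 by rewrite ltW.
have Q0R : 0 < Q%:R :> R by rewrite ltr0n.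
have T2 : (2 <= #|T|)%N by rewrite Tm -[2%N]/(1.*2) leq_double.
have n2 : 2 <= n by rewrite ler_nat.
have n0 : 0 < n by lra.
have ln_half : 2^-1 <= ln n.
  by apply: (le_trans (ln2_ge_half R)); rewrite ler_ln ?posrE.
have ln0 : 0 < ln n by lra.
have cpn0 : 0 < c * p * n by rewrite !mulr_gt0.
have deg_ge x : c * p * n <= (degree G x)%:R.
  by apply: (le_trans min_deg); rewrite ler_nat min_degree_le.
have [A [Am Bm stable]] := exists_swap_stable G Tm.
have [x0 _] : exists x0 : T, x0 \in A by apply/card_gt0P; rewrite Am.
(* A default edge for [insubd] below. *)
have [e0 _] : exists e0 : edge G, true.
  have : (0 < degree G x0)%N by rewrite -(ltr0n R); apply: lt_le_trans (deg_ge x0).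
  rewrite /degree => /card_gt0P[y]; rewrite inE => Gxy.
  have exy : [set x0; y] \in edges G.
    by rewrite inE; apply/existsP; exists x0; apply/existsP; exists y; rewrite Gxy eqxx.
  by exists (exist (fun e => e \in edges G) _ exy).
(* Chosen so that [q * (c / 8 * p * n) = 8 * ln n], as [crossing_pm_prob] requires. *)
pose q : R := 64 * ln n / (c * p * n).
have rho_ge' : 260 * 256 * ln n ^+ 2 <= rho * (c * p * n).
  by move: rho_ge; rewrite mulrAC ler_pdivrMr //; lra.
have q0 : 0 < q by rewrite divr_gt0 // mulr_gt0.
have q1 : q <= 1.
  rewrite ler_pdivrMr // mul1r.
  have h1 : rho * (c * p * n) <= 1 * (c * p * n) by rewrite ler_wpM2r // ltW.
  have h2 : ln n * 2^-1 <= ln n * ln n by rewrite ler_wpM2l // ltW.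
  by move: rho_ge'; rewrite expr2; lra.
have q01 : 0 <= q <= 1 by rewrite ltW.
have half : 2^-1 <= good_prob (@has_crossing_pm T G A) q.
  apply: (crossing_pm_prob (d := c / 8 * p * n) Am Bm Q0 q01).
    by rewrite -/n /q le_eqVlt; apply/orP; left; apply/eqP; field; rewrite !gt_eqF.
  move=> Y S U YA /and4P[SY UY US Sm].
  have dir (X X' : {set T}) : #|X| = Q -> #|X'| = Q -> swap_stable G X X' ->
      forall u, u \in X -> c * p * n <= 4 * (deg_in G X' u)%:R.
    by move=> Xm X'm st; apply: (swap_stable_deg Tm jumbled beta0 p0 c0 deg_ge beta_le
      Q0 Xm X'm st).
  have [Ym CYm st] : [/\ #|Y| = Q, #|~: Y| = Q & swap_stable G (~: Y) Y].
    by case: YA => ->; rewrite ?setCK; split=> //; apply: swap_stableC.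
  exact: (expansion Tm jumbled beta0 p0 c0 c1 beta_le Q0 CYm Ym (dir _ _ CYm Ym st) SY
    UY US Sm).
pose alpha (i : 'I_Q) : T := enum_val (cast_ord (esym Am) i).
have alpha_inj : injective alpha by move=> i j /enum_val_inj/cast_ord_inj.
have alphaA i : alpha i \in A by apply: enum_valP.
pose f (F : {set edge G}) : {ffun T -> T} := odflt [ffun x => x] [pick f |
  crossing_pm A F f].
pose mt (F : {set edge G}) (i : 'I_Q) : edge G := insubd e0 [set alpha i; f F (alpha i)].
have fP F : has_crossing_pm A F -> crossing_pm A F (f F).
  by rewrite /f => /existsP[g gP]; case: pickP => [//|/(_ g)]; rewrite gP.
have f_inj F : has_crossing_pm A F -> {in A &, injective (f F)}.
  by move=> /fP/andP[/dinjectiveP].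
have fA F : has_crossing_pm A F -> forall x, x \in A -> f F x \notin A.
  by move=> /fP/andP[_ /forall_inP fA] x /fA/andP[].
have mtP F : has_crossing_pm A F -> forall i,
  mt F i \in F /\ val (mt F i) = [set alpha i; f F (alpha i)].
  move=> /fP/andP[_ /forall_inP fA'] i;
    have /andP[_ /exists_inP[e eF /eqP ee]] := fA' _ (alphaA i).
  by rewrite /mt -ee valKd.
have mtE F gF i := (mtP F gF i).2.
have mt_inj F : has_crossing_pm A F -> injective (mt F).
  by move=> gF; apply: (crossing_edges_inj alpha_inj alphaA (fA F gF) (mtE F gF)).
pose lam := coloured_measure (has_crossing_pm A) mt q.
have lam_spread : spread (8 * q / Q%:R) lam.
  have := coloured_measure_spread q01 half mt_inj (fun F gF i => (mtP F gF i).1).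
  by rewrite card_ord.
have lam_bounded : support_bounded Q lam.
  by have := @coloured_measure_bounded R _ _ _ mt q mt_inj; rewrite card_ord.
set k := trunc_log 2 #|T| in sk *.
have k_ln : k%:R <= 2 * ln n by apply: trunc_log_le_ln; apply: ltnW.
have k0 : 0 <= k%:R :> R by [].
have rhoQ1 : rho / Q%:R <= 1.
  by rewrite ler_pdivrMr // mul1r (le_trans rho1) // ler1n.
have hp : 1 - (s%:R ^+ 2 / k%:R + 2 * 16^-1 ^+ s) <= hit_prob (rho / Q%:R) lam.
  rewrite -[X in X - _](mass_coloured_measure mt half) -/lam.
  apply: (@hit_prob_rounds _ _ k s k%:R _ _ lam s0 _ _ _ rhoQ1 lam_spread).
  - by rewrite ler_nat.
  - by rewrite divr_gt0 // mulr_gt0.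
  (* The rounds use density [65 * k * (8 * q / Q)]; since [k <= 2 * ln n], it suffices that [65 *
     1024 * ln n ^+ 2 <= rho * (c * p * n)], and [65 * 1024 = 260 * 256]. *)
  - rewrite natrM.
    have -> : 8 * q / Q%:R = (512 * ln n / (c * p * n)) / Q%:R.
      by rewrite /q; field; rewrite !gt_eqF.
    rewrite mulrA ler_wpM2r ?invr_ge0 // mulrA ler_pdivrMr //.
    apply: le_trans rho_ge'.
    have h : k%:R * ln n <= 2 * ln n * ln n by rewrite ler_wpM2r // ltW.
    by rewrite expr2; lra.
  move=> X /lam_bounded /leq_trans; apply.
  have : (#|T| < 2 ^ k.+1)%N by apply: trunc_log_ltn.
  rewrite Tm expnS -muln2 mulnC ltn_pmul2l // => /ltnW /leq_trans; apply.
  by rewrite leq_pmull.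
apply: (le_trans hp); rewrite /hit_prob enum_prod.
have lam1 X : lam X != 0 -> {in X &, injective fst}.
  move=> /coloured_measure_neq0[F gF [sigma ->]] _ _ /imsetP[i _ ->] /imsetP[j _ ->] /=.
  by move=> /(mt_inj F gF) ->.
have := expect_le_colour (C := 'I_Q) (enum (edge G)) rho01 _ (@hits_mono _ _ lam)
  (hits_one_colour lam1).
rewrite card_ord => /(_ Q0) /le_trans; apply.
apply: prob_colour_perc_expect => // chi F.
case: (boolP (hits lam _)) => [/existsP[X /andP[]]|_]; last by rewrite ler0n.
move=> /coloured_measure_neq0[F' gF' [sigma ->]] sub.
by rewrite (coloured_has_rainbow_pm alpha_inj alphaA Am Bm (f_inj F' gF') (fA F' gF')
  (mtE F' gF') sub).
Qed.

End FiniteBound.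

(** * Passage to the limit *)

Lemma error_term_small (R : realType) (eps : R) : 0 < eps ->
  exists s K : nat, (0 < s <= K)%N /\
    forall k, (K <= k)%N -> s%:R ^+ 2 / k%:R + 2 * 16^-1 ^+ s <= eps.
Proof.
move=> eps0; have eps4 : 0 <= 4 / eps by rewrite divr_ge0 // ltW.
(* First [s] makes the exponential term small, then [K] is taken large in terms of [s]. *)
have [s s_gt] : exists s : nat, 4 / eps < s%:R.
  by exists (Num.bound (4 / eps)); apply: archi_boundP.
have s0R : 0 < s%:R :> R by apply: le_lt_trans s_gt.
have s0 : (0 < s)%N by rewrite -(ltr0n R).
have eps2 : 0 <= s%:R ^+ 2 * 2 / eps by rewrite divr_ge0 ?mulr_ge0 ?exprn_ge0 // ltW.
have [K0 K0_gt] : exists K : nat, s%:R ^+ 2 * 2 / eps < K%:R.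
  by exists (Num.bound (s%:R ^+ 2 * 2 / eps)); apply: archi_boundP.
exists s, (maxn s K0); rewrite s0 leq_maxl; split=> // k; rewrite geq_max => /andP[sk Kk].
have k0 : 0 < k%:R :> R by rewrite ltr0n (leq_trans s0).
have h1 : s%:R ^+ 2 / k%:R <= eps / 2.
  rewrite ler_pdivrMr //; rewrite ltr_pdivrMr // in K0_gt.
  have : K0%:R * eps <= k%:R * eps by rewrite ler_wpM2r ?ler_nat // ltW.
  by move: K0_gt; lra.
have h2 : 2 * 16^-1 ^+ s <= eps / 2.
  rewrite exprVn ler_pdivrMr ?exprn_gt0 //; rewrite ltr_pdivrMr // in s_gt.
  have : eps * s%:R <= eps * 16 ^+ s.
    by rewrite ler_wpM2l ?(ltW eps0) // -natrX ler_nat ltnW // ltn_expl.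
  by move: s_gt; lra.
lra.
Qed.

Unset Implicit Arguments.
From mathcomp Require Import all_classical all_reals all_analysis.
Import numFieldNormedType.Exports.
Import Order.TTheory GRing.Theory Num.Theory.
Local Open Scope classical_set_scope.
Local Open Scope ring_scope.


(** [I] is the set of orders [n] at which the hypotheses hold; they are all even, so the limit is
    taken within [I]. *)
Theorem theorem1p11 (R : realType) (c : R) (c_gt0 : 0 < c) :
  exists C gamma : R, 0 < C /\ 0 < gamma /\
  forall (I : set nat) (V : nat -> finType) (G : forall n, sgraph (V n))
         (p beta rho : nat -> R),
    (forall n, I n -> #|V n| = n) ->
    (forall n, I n -> 0 < p n <= 1) ->
    (forall n, I n -> 0 <= beta n) ->
    (forall n, I n -> 0 < rho n <= 1) ->
    (forall n, I n -> bijumbled (G n) (p n) (beta n)) ->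
    (forall n, I n -> c * p n * n%:R <= (min_degree (G n))%:R) ->
    (forall n, I n -> beta n <= gamma * p n * n%:R) ->
    (forall n, I n -> C * (ln n%:R) ^+ 2 <= rho n * p n * n%:R) ->
    (forall n, I n -> (2 %| n)%N) ->
    prob_colour_perc (rho n) (@has_rainbow_pm (V n) (G n) (n %/ 2)%N)
      @[n --> within I \oo] --> (1 : R).
Proof.
(* [expansion] asks for a constant at most 1, and lowering [c] only weakens the degree condition. *)
pose c0 : R := Num.min c 1.
have c0_gt0 : 0 < c0 by rewrite lt_min c_gt0 ltr01.
have c0_le1 : c0 <= 1 by rewrite ge_min lexx orbT.
exists (260 * 256 / c0), (c0 / 128); split; first by rewrite divr_gt0 // mulr_gt0.
split; first by rewrite divr_gt0.
move=> I V G p beta rho Vn p01 beta0 rho01 jumbled min_deg beta_le rho_ge even_n.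
apply/cvgrPdist_le => eps eps0; have [s [K [/andP[s0 sK] small]]] := error_term_small eps0.
(* From [2 ^ K] on, the number [trunc_log 2 n] of rounds is at least [K]. *)
rewrite near_withinE; exists (2 ^ K)%N => // n /= Kn In.
have n0 : (0 < n)%N by apply: leq_trans Kn; rewrite expn_gt0.
have K_log : (K <= trunc_log 2 n)%N by apply: trunc_log_max.
have nE : n = (n %/ 2).*2 by rewrite -muln2 divnK // even_n.
have Q0 : (0 < n %/ 2)%N by move: n0; rewrite {1}nE double_gt0.
have /andP[p0 _] := p01 n In; have /andP[rho0 rho1] := rho01 n In.
have le1 : prob_colour_perc (rho n) (@has_rainbow_pm (V n) (G n) (n %/ 2)%N) <= 1.
  by apply: prob_colour_perc_le1 => //; rewrite ltW.
rewrite ger0_norm ?subr_ge0 // lerBlDr addrC -lerBlDr.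
apply: le_trans (_ : 1 - (s%:R ^+ 2 / (trunc_log 2 n)%:R + 2 * 16^-1 ^+ s) <= _).
  by rewrite lerD2l lerN2 small.
have := @rainbow_pm_prob_ge R (V n) (G n) (n %/ 2) c0 (p n) (beta n) (rho n) s.
rewrite Vn //; apply => //.
- by rewrite c0_gt0.
- by rewrite beta0.
- by rewrite rho0.
- exact: jumbled.
- apply: le_trans (min_deg n In); rewrite ler_wpM2r // ler_wpM2r ?(ltW p0) //.
  by rewrite ge_min lexx.
- exact: beta_le.
- exact: rho_ge.
by rewrite s0 (leq_trans sK).
Qed.
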